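(* The space of axially harmonic functions is generated by polynomials of the form $$H_k^0(x)=HGCK[x_0^k,0],\qquad H_k^1(x)=HGCK[0,x_0^k],\qquad x\in\mathbb{R}^{m+1}.$$ Moreover, one has that $$H_k^0(x)=[\mathcal{Q}_k^m(x)]_0\qquad\text{and}\qquad H_k^1(x)=\frac m{k+1}[\mathcal{Q}_{k+1}^m(x)]_1,$$ where the polynomials $\mathcal{Q}_k^m(x)$ are the Clifford–Appell polynomials.
   Context: $m\in\mathbb{N}$ and $k\ge0$ is an integer. $\mathbb{R}_m$ is the real associative Clifford algebra generated by $e_1,\dots,e_m$ with $e_je_\ell+e_\ell e_j=-2\delta_{j\ell}$; points of $\mathbb{R}^{m+1}$ are paravectors $x=x_0+\underline{x}$, $\underline{x}=\sum_{j=1}^mx_je_j$, $\bar{x}=x_0-\underline{x}$. $[\cdot]_0,[\cdot]_1$ are the scalar and 1-vector parts of an element of $\mathbb{R}_m$. A real-analytic $\mathbb{R}_m$-valued function is axially harmonic if it has the form $\alpha(x_0,|\underline{x}|)+\frac{\underline{x}}{|\underline{x}|}\beta(x_0,|\underline{x}|)$ with $\alpha,\beta$ real-analytic $\mathbb{R}_m$-valued, $\alpha$ even and $\beta$ odd in the second variable, and it lies in the kernel of $\Delta_{\mathbb{R}^{m+1}}=\sum_{j=0}^m\partial_{x_j}^2$. For analytic $A_0,A_1$ of the real variable $x_0$, the harmonic generalized Cauchy–Kovalevskaya extension is $$HGCK[A_0,A_1](x_0,\underline{x})=\Gamma\left(\tfrac m2\right)\left[\sum_{j\ge0}\frac{(-1)^j|\underline{x}|^{2j}A_0^{(2j)}(x_0)}{2^{2j}j!\,\Gamma(\frac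 m2+j)}+\frac m2\,\underline{x}\sum_{j\ge0}\frac{(-1)^j|\underline{x}|^{2j}A_1^{(2j)}(x_0)}{2^{2j}j!\,\Gamma(\frac m2+j+1)}\right].$$ The Clifford–Appell polynomials are $\mathcal{Q}_k^m(x)=\sum_{s=0}^k\binom ks\frac{\left(\frac{m+1}2\right)_{k-s}\left(\frac{m-1}2\right)_s}{(m)_k}x^{k-s}\bar{x}^s$, with $(a)_s=\Gamma(a+s)/\Gamma(a)$ the Pochhammer symbol. *)

(* Defs.v *)
From HB Require Import structures.
From mathcomp Require Import all_boot all_order all_algebra.
From mathcomp Require Import all_classical all_reals all_analysis.
From mathcomp Require Import ring.
Set Implicit Arguments.
Unset Strict Implicit.
Unset Printing Implicit Defensive.
Import Order.TTheory GRing.Theory Num.Theory.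
Import numFieldNormedType.Exports.
Local Open Scope ring_scope.

(* The Clifford algebra R_m with e_j e_l + e_l e_j = -2 delta_jl, realised on
   its standard basis e_A = e_{j_1} ... e_{j_p}, A = {j_1 < ... < j_p}; an
   element is the vector of its coordinates, so that R_m is normed by the
   supremum of the coordinates. *)
Definition clifford (R : realType) (m : nat) : Type :=
  'rV[R]_(#|{set 'I_m}|).

HB.instance Definition _ (R : realType) (m : nat) :=
  NormedModule.copy (clifford R m) 'rV[R]_(#|{set 'I_m}|).

Section CliffordAlgebra.
Variables (R : realType) (m : nat).
Local Notation C := (clifford R m).
Implicit Types (A B D : {set 'I_m}) (a b c : C).

Definition coef a A : R := (a : 'rV_(#|{set 'I_m}|)) 0 (enum_rank A).

Definition of_coef (F : {set 'I_m} -> R) : C := \row_i F (enum_val i).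

Definition symdiff A B : {set 'I_m} := (A :\: B) :|: (B :\: A).

(* e_A e_B = csign A B *: e_(A symdiff B): one factor -1 for each transposition
   of generators (j < i) and one for each square e_i ^ 2 = -1 (j = i). *)
Definition csign A B : R :=
  \prod_(i in A) \prod_(j in B) (if (j <= i)%N then -1 else 1).

Definition cmul a b : C :=
  of_coef (fun D => \sum_A coef a A * coef b (symdiff A D)
                              * csign A (symdiff A D)).

Definition ebasis A : C := of_coef (fun D => (D == A)%:R).

Lemma coefK (F : {set 'I_m} -> R) A : coef (of_coef F) A = F A.
Proof. by rewrite /coef /of_coef mxE enum_rankK. Qed.

Lemma clifford_eqP a b : coef a =1 coef b -> a = b.
Proof.
by move=> ab; apply/rowP => i; have := ab (enum_val i); rewrite /coef enum_valK.
Qed.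

Lemma coefD a b A : coef (a + b) A = coef a A + coef b A.
Proof. by rewrite /coef mxE. Qed.

Lemma coefZ (k : R) a A : coef (k *: a) A = k * coef a A.
Proof. by rewrite /coef mxE. Qed.

Lemma in_symdiff A B i : (i \in symdiff A B) = (i \in A) (+) (i \in B).
Proof. by rewrite !inE; case: (i \in A); case: (i \in B). Qed.

Lemma symdiffA A B D : symdiff A (symdiff B D) = symdiff (symdiff A B) D.
Proof. by apply/finset.setP => i; rewrite !in_symdiff addbA. Qed.

Lemma symdiffC A B : symdiff A B = symdiff B A.
Proof. by apply/finset.setP => i; rewrite !in_symdiff addbC. Qed.

Lemma symdiffK A : involutive (symdiff A).
Proof. by move=> B; apply/finset.setP => i; rewrite !in_symdiff addKb. Qed.

Lemma symdiff0 A : symdiff A finset.set0 = A.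
Proof. by apply/finset.setP => i; rewrite in_symdiff inE addbF. Qed.

Lemma prod_symdiff (f : 'I_m -> R) A B : (forall i, f i * f i = 1) ->
  \prod_(i in symdiff A B) f i = (\prod_(i in A) f i) * \prod_(i in B) f i.
Proof.
move=> f2; rewrite [LHS]big_mkcond [X in X * _]big_mkcond.
rewrite [X in _ * X]big_mkcond -big_split; apply: eq_bigr => i _.
by rewrite in_symdiff; case: (i \in A); case: (i \in B);
  rewrite /= ?f2 ?mulr1 ?mul1r.
Qed.

Lemma csignDl A B D : csign (symdiff A B) D = csign A D * csign B D.
Proof.
apply: prod_symdiff => i; rewrite -big_split big1//= => j _.
by case: ifP; rewrite ?mulrNN mulr1.
Qed.

Lemma csignDr A B D : csign A (symdiff B D) = csign A B * csign A D.
Proof.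
rewrite /csign -big_split; apply: eq_bigr => i _; apply: prod_symdiff => j.
by case: ifP; rewrite ?mulrNN mulr1.
Qed.

Lemma csign0l A : csign finset.set0 A = 1.
Proof. by rewrite /csign big_set0. Qed.

Lemma csign0r A : csign A finset.set0 = 1.
Proof. by rewrite /csign big1// => i _; rewrite big_set0. Qed.

Lemma cmulA : associative cmul.
Proof.
move=> a b c; apply: clifford_eqP => D; rewrite /cmul !coefK.
under eq_bigr => A _ do rewrite coefK mulr_sumr mulr_suml.
under [RHS]eq_bigr => A _ do rewrite coefK !mulr_suml.
rewrite [RHS]exchange_big /=; apply: eq_bigr => A _.
rewrite [RHS](reindex_inj (inv_inj (symdiffK A))) /=; apply: eq_bigr => B _.
have -> : symdiff (symdiff A B) D = symdiff B (symdiff A D).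
  by rewrite (symdiffC A) symdiffA.
rewrite symdiffK; set E := symdiff B _.
have -> : symdiff A D = symdiff B E by rewrite symdiffK.
by rewrite csignDl csignDr; ring.
Qed.

Lemma cmul1l : left_id (ebasis finset.set0) cmul.
Proof.
move=> a; apply: clifford_eqP => D; rewrite /cmul coefK (bigD1 finset.set0)//=.
rewrite coefK eqxx mul1r csign0l mulr1 symdiffC symdiff0 big1 ?addr0// => A nA.
by rewrite coefK (negbTE nA) !mul0r.
Qed.

Lemma cmul1r : right_id (ebasis finset.set0) cmul.
Proof.
move=> a; apply: clifford_eqP => D; rewrite /cmul coefK (bigD1 D)//=.
have sDD : symdiff D D = finset.set0 by rewrite -{2}(symdiff0 D) symdiffK.
rewrite sDD coefK eqxx mulr1 csign0r mulr1 big1 ?addr0// => A nA.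
rewrite coefK; case: eqP => [AD|]; last by rewrite mulr0 mul0r.
by case/eqP: nA; rewrite -(symdiffK A D) AD symdiff0.
Qed.

Lemma cmulDl : left_distributive cmul +%R.
Proof.
move=> a b c; apply: clifford_eqP => D; rewrite coefD /cmul !coefK -big_split.
by apply: eq_bigr => A _; rewrite coefD !mulrDl.
Qed.

Lemma cmulDr : right_distributive cmul +%R.
Proof.
move=> a b c; apply: clifford_eqP => D; rewrite coefD /cmul !coefK -big_split.
by apply: eq_bigr => A _; rewrite coefD mulrDr mulrDl.
Qed.

Lemma cone_neq0 : ebasis finset.set0 != 0.
Proof.
apply/eqP => /(congr1 (coef^~ finset.set0)); rewrite coefK eqxx /coef mxE.
by move/eqP; rewrite oner_eq0.
Qed.

HB.instance Definition _ := GRing.Zmodule_isNzRing.Build C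
  cmulA cmul1l cmul1r cmulDl cmulDr cone_neq0.

Lemma cscaleAl (k : R) (a b : C) : k *: (a * b) = k *: a * b.
Proof.
apply: clifford_eqP => D; rewrite coefZ !coefK mulr_sumr.
by apply: eq_bigr => A _; rewrite coefZ !mulrA.
Qed.

HB.instance Definition _ := GRing.Lmodule_isLalgebra.Build R C cscaleAl.

Lemma cscaleAr (k : R) (a b : C) : k *: (a * b) = a * (k *: b).
Proof.
apply: clifford_eqP => D; rewrite coefZ !coefK mulr_sumr.
by apply: eq_bigr => A _; rewrite coefZ; ring.
Qed.

HB.instance Definition _ := GRing.Lalgebra_isAlgebra.Build R C cscaleAr.

Definition egen (j : 'I_m) : C := ebasis [set j].

Lemma ebasisM A B : ebasis A * ebasis B = csign A B *: ebasis (symdiff A B).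
Proof.
apply: clifford_eqP => D; rewrite coefZ !coefK (bigD1 A)//= !coefK eqxx mul1r.
rewrite big1 ?addr0 => [|E nE]; last by rewrite coefK (negbTE nE) !mul0r.
have -> : (D == symdiff A B) = (symdiff A D == B).
  by rewrite -{1}(symdiffK A D) (inj_eq (inv_inj (symdiffK A))).
by case: eqP => [->|]; rewrite ?mulr1 ?mul1r ?mulr0 ?mul0r.
Qed.

Lemma egen_anticomm (j l : 'I_m) :
  egen j * egen l + egen l * egen j = (-2 * (j == l)%:R) *: 1.
Proof.
have csg i k : csign [set i] [set k] = if (k <= i)%N then -1 else 1.
  by rewrite /csign !big_set1.
rewrite /egen !ebasisM (symdiffC [set l]) -scalerDl !csg.
case: eqP => [->|/eqP njl].
  by rewrite leqnn -{2}(symdiff0 [set l]) symdiffK mulr1 -opprD.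
have := njl; rewrite -(inj_eq val_inj) neq_ltn => /orP[] h.
  by rewrite (ltnW h) leqNgt h /= addrN mulr0 !scale0r.
by rewrite (ltnW h) leqNgt h /= addNr mulr0 !scale0r.
Qed.

Definition grade (p : nat) (a : C) : C :=
  \sum_(A : {set 'I_m} | #|A| == p) coef a A *: ebasis A.

End CliffordAlgebra.

Local Open Scope classical_set_scope.
Local Open Scope ring_scope.

Section Paravectors.
Variables (R : realType) (m : nat).
Local Notation pt := 'rV[R]_m.+1.

Definition x0of (x : pt) : R := x 0 ord0.

Definition vpart (x : pt) : clifford R m :=
  \sum_(j < m) x 0 (lift ord0 j) *: egen R j.

Definition paravec (x : pt) : clifford R m := (x0of x)%:A + vpart x.

Definition paraconj (x : pt) : clifford R m := (x0of x)%:A - vpart x.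

Definition vnorm (x : pt) : R :=
  Num.sqrt (\sum_(j < m) x 0 (lift ord0 j) ^+ 2).

End Paravectors.

Section Analytic.
Variables (R : realType) (n : nat) (V : normedModType R).

(* Exponents of total degree k in n variables: they are bounded by k. *)
Definition mdeg (k : nat) (s : {ffun 'I_n -> 'I_k.+1}) : nat := \sum_i s i.

Definition monom (h : 'rV[R]_n) (k : nat) (s : {ffun 'I_n -> 'I_k.+1}) : R :=
  \prod_i h 0 i ^+ s i.

Definition homog (c : forall k, {ffun 'I_n -> 'I_k.+1} -> V) (h : 'rV[R]_n)
    (k : nat) : V :=
  \sum_(s : {ffun 'I_n -> 'I_k.+1} | mdeg s == k) monom h s *: c k s.

(* Here `|h| is the supremum norm on R^n: the power series converges absolutely
   on the polydisc of polyradius (r, ..., r) centred at p, with sum f. *)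
Definition analytic_at (f : 'rV[R]_n -> V) (p : 'rV[R]_n) : Prop :=
  exists (c : forall k, {ffun 'I_n -> 'I_k.+1} -> V) (r : R),
    [/\ 0 < r,
        cvgn (series (fun k =>
          \sum_(s : {ffun 'I_n -> 'I_k.+1} | mdeg s == k) `|c k s| * r ^+ k))
      & forall h, `|h| < r -> series (homog c h) @ \oo --> f (p + h)].

Definition analytic_on (U : set 'rV[R]_n) (f : 'rV[R]_n -> V) : Prop :=
  forall p, U p -> analytic_at f p.

Definition polynomial_fun (f : 'rV[R]_n -> V) : Prop :=
  exists (d : nat) (c : forall k, {ffun 'I_n -> 'I_k.+1} -> V),
    forall x, f x = \sum_(k < d) homog c x k.

End Analytic.

Section AxiallyHarmonic.
Variables (R : realType) (m : nat).
Local Notation pt := 'rV[R]_m.+1.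

Definition laplacian (f : pt -> clifford R m) (x : pt) : clifford R m :=
  \sum_(j < m.+1) 'D_(delta_mx 0 j) ('D_(delta_mx 0 j) f) x.

Definition axially_symmetric (W : set pt) : Prop :=
  forall x y, x0of x = x0of y -> vnorm x = vnorm y -> W x -> W y.

(* The set of all (u, v), v of either sign, such that the points x with
   x_0 = u and |x_| = |v| lie in W. *)
Definition profile (W : set pt) : set 'rV[R]_2 :=
  [set p | exists x, [/\ W x, x0of x = p 0 0 & vnorm x = `|p 0 1|]].

Definition axially_harmonic (W : set pt) (f : pt -> clifford R m) : Prop :=
  [/\ analytic_on W f,
      (exists alpha beta : R -> R -> clifford R m,
        [/\ analytic_on (profile W) (fun p : 'rV[R]_2 => alpha (p 0 0) (p 0 1)),
            analytic_on (profile W) (fun p : 'rV[R]_2 => beta (p 0 0) (p 0 1)),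
            (forall p, profile W p ->
              alpha (p 0 0) (- p 0 1) = alpha (p 0 0) (p 0 1)),
            (forall p, profile W p ->
              beta (p 0 0) (- p 0 1) = - beta (p 0 0) (p 0 1))
          & forall x, W x ->
              f x = alpha (x0of x) (vnorm x)
                    + (vnorm x)^-1 *: vpart x * beta (x0of x) (vnorm x)])
    & forall x, W x -> laplacian f x = 0].

End AxiallyHarmonic.

Definition Gamma (R : realType) (a : R) : R :=
  (\int[lebesgue_measure]_(t in `]0%R, +oo[) (t `^ (a - 1) * expR (- t)))%R.

(* For a = 0 (which occurs in the Clifford-Appell polynomials when m = 1) the
   quotient of Gamma functions is read as its limit a --> 0. *)
Definition poch (R : realType) (a : R) (s : nat) : R :=
  if a == 0 then (s == 0%N)%:R else Gamma (a + s%:R) / Gamma a.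

Definition HGCK (R : realType) (m : nat) (A0 A1 : R -> clifford R m)
    (x : 'rV[R]_m.+1) : clifford R m :=
  let mh : R := m%:R / 2 in
  let r := vnorm x in
  Gamma mh *:
    (limn (series (fun j : nat =>
       ((-1) ^+ j * r ^+ (2 * j) / (2 ^+ (2 * j) * j`!%:R * Gamma (mh + j%:R)))
         *: derive1n (2 * j) A0 (x0of x)))
     + mh *: (vpart x * limn (series (fun j : nat =>
       ((-1) ^+ j * r ^+ (2 * j)
          / (2 ^+ (2 * j) * j`!%:R * Gamma (mh + j%:R + 1)))
         *: derive1n (2 * j) A1 (x0of x))))).

Definition H0 (R : realType) (m k : nat) : 'rV[R]_m.+1 -> clifford R m :=
  HGCK (fun t => (t ^+ k)%:A) (fun=> 0).

Definition H1 (R : realType) (m k : nat) : 'rV[R]_m.+1 -> clifford R m :=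
  HGCK (fun=> 0) (fun t => (t ^+ k)%:A).

Definition clifford_appell (R : realType) (m k : nat) (x : 'rV[R]_m.+1) :
    clifford R m :=
  \sum_(s < k.+1)
    ('C(k, s)%:R * (poch ((m%:R + 1) / 2) (k - s) * poch ((m%:R - 1) / 2) s
                    / poch (m%:R : R) k))
      *: (paravec x ^+ (k - s) * paraconj x ^+ s).

(* Main.v *)
(* In a neighbourhood of 0 an axially harmonic function is
   f(x) = E(x) + x_ O(x), where E and O are convergent sums of homogeneous axial
   polynomials \sum_j c_j x0^(k-2j) |x_|^(2j), obtained from the even part of alpha
   and the odd part of beta.  Termwise differentiation and homogeneity show that
   each component of E and of x_ O is harmonic.  Harmonicity is a first order
   recursion on the c_j, so a component is determined by its coefficient c_0: it is
   H_k^0 c_0, respectively H_k^1 c_0.  The recursion is governed by the dimension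
   parameter m for E and m + 2 for O, which accounts for Gamma(m/2 + j) and
   Gamma(m/2 + j + 1) in HGCK.

   The Clifford-Appell polynomials satisfy d/dx0 Q_(k+1) = (k+1) Q_k, so they are
   determined by their values at x0 = 0, which up to normalization are the
   coefficients of
   (1-z)^(-(m+1)/2) (1+z)^(-(m-1)/2) = (1+z) (1-z^2)^(-(m+1)/2). *)

Require Import Defs.
From mathcomp Require Import all_boot all_order all_algebra.
From mathcomp Require Import all_classical all_reals all_analysis.
From mathcomp Require Import measurable_realfun ring lra.
Import Order.TTheory GRing.Theory Num.Theory.
Import numFieldNormedType.Exports.
Set Implicit Arguments.
Unset Strict Implicit.
Unset Printing Implicit Defensive.
Local Open Scope classical_set_scope.
Local Open Scope ring_scope.

(** * The Gamma function and rising factorials *)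

(** The delicate point is to pass from harmonicity of a sum to harmonicity of each homogeneous
    component, for functions known only through power series with values in a noncommutative
    algebra. The work is done on real coordinates with respect to the basis e_A: left multiplication
    by e_l permutes them up to sign, so a coordinate of f is E(x0, |x_|^2) plus a sum of terms x_l
    O_l(x0, |x_|^2). The variable w = |x_|^2, unlike |x_|, has no singularity on the axis x_ = 0,
    and the Laplacian then involves only derivatives in u alone or in w alone, hence series of
    one-variable polynomials. The two parts are separated by evaluating at x0 + v e_1 and x0 - v
    e_1. Homogeneity enters through the scaling (t u, t^2 w), which up to a factor t^2 turns the
    Laplacian into a power series in t whose coefficients vanish one by one. For O this gives
    information on e_1 O only, which suffices because e_1^2 = -1. *)

Section RisingFactorial.
Variable F : numFieldType.
Implicit Types a b : F.

Definition rising a n : F := \prod_(i < n) (a + i%:R).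

Lemma rising0 a : rising a 0 = 1. Proof. exact: big_ord0. Qed.

Lemma risingS a n : rising a n.+1 = rising a n * (a + n%:R).
Proof. exact: big_ord_recr. Qed.

Lemma risingSl a n : rising a n.+1 = a * rising (a + 1) n.
Proof.
rewrite /rising big_ord_recl/= addr0; congr (_ * _); apply: eq_bigr => i _.
by rewrite -addrA nat1r.
Qed.

Lemma rising_gt0 a n : 0 < a -> 0 < rising a n.
Proof. by move=> a0; apply: prodr_gt0 => i _; rewrite ltr_wpDr. Qed.

(** Duplication formula: consecutive factors pair up as (a + 2i)(a + 2i + 1) = 4 (a/2 + i)((a + 1)/2
    + i). It turns the (m)_k of the Clifford-Appell polynomials into the parameters m/2 and m/2 + 1
    of the extension. *)
Lemma rising_double a n :
  rising a (2 * n)%N = 4 ^+ n * rising (a / 2) n * rising ((a + 1) / 2) n.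
Proof.
elim: n => [|n IH]; first by rewrite !rising0 !mulr1.
rewrite mulnS !risingS IH -(natr1 (2 * n)%N) natrM exprS.
by field.
Qed.

Definition altconv a b n : F :=
  \sum_(s < n.+1) rising a (n - s) / (n - s)`!%:R *
                  ((-1) ^+ s * rising b s / s`!%:R).

(* Coefficients of (1 - z)^(-a) (1 + z)^(-b) = (1 + z) (1 - z^2)^(-a) for
   a = b + 1; d and e are the coefficients of z g1' g2 and z g1 g2' where
   g1, g2 are the two factors. *)
Lemma altconvE b n :
  altconv (b + 1) b n = rising (b + 1) n./2 / n./2`!%:R.
Proof.
set a := b + 1.
pose A n := rising a n / n`!%:R; pose B n := (-1) ^+ n * rising b n / n`!%:R.
pose g n := \sum_(s < n.+1) A (n - s)%N * B s.
pose d n := \sum_(s < n.+1) (n - s)%:R * A (n - s)%N * B s.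
pose e n := \sum_(s < n.+1) s%:R * A (n - s)%N * B s.
have fact0 k : k`!%:R != 0 :> F by rewrite pnatr_eq0 -lt0n fact_gt0.
have k0 k : k.+1%:R != 0 :> F by rewrite pnatr_eq0.
have AS k : k.+1%:R * A k.+1 = (a + k%:R) * A k.
  by rewrite /A risingS factS natrM; field; rewrite fact0 nat1r k0.
have BS k : k.+1%:R * B k.+1 = - (b + k%:R) * B k.
  by rewrite /B risingS factS natrM exprS; field; rewrite fact0 nat1r k0.
have A0 : A 0%N = 1 by rewrite /A rising0 divr1.
have B0 : B 0%N = 1 by rewrite /B rising0 divr1 mulr1.
have -> : altconv a b n = g n by [].
rewrite -/(A _); clearbody A B.
(* [dS] and [eS] are the coefficient forms of (1 - z) g1' = a g1 and (1 + z) g2' = - b g2, and [deS]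
   that of the product rule for z (g1 g2)'. *)
have dS k : d k.+1 = a * g k + d k.
  rewrite /d big_ord_recr/= subnn !mul0r addr0 mulr_sumr -big_split/=.
  apply: eq_bigr => s _; rewrite subSn ?leq_ord// AS; ring.
have eS k : e k.+1 = - b * g k - e k.
  rewrite /e big_ord_recl/= !mul0r add0r mulr_sumr -sumrB; apply: eq_bigr => s _.
  rewrite /bump/= add1n subSS mulrAC BS; ring.
have deS k : d k + e k = k%:R * g k.
  rewrite -big_split mulr_sumr; apply: eq_bigr => s _ /=.
  have -> : k%:R = (k - s)%N%:R + s%:R :> F by rewrite -natrD subnK ?leq_ord.
  ring.
(* Since a = b + 1, z g1 g2' = - b z (1 - z^2)^(-a) is odd in z; the vanishing of [e] at even
   indices is the invariant that closes the induction by steps of two. *)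
have even j : g (2 * j)%N = A j /\ e (2 * j)%N = 0.
  elim: j => [|j [IH1 IH2]].
    by rewrite muln0 /g /e !big_ord1 !mul0r A0 B0 mulr1.
  have dj : d (2 * j)%N = (2 * j)%N%:R * A j.
    by rewrite -(addr0 (d _)) -IH2 deS IH1.
  have g1 : g (2 * j).+1%N = A j.
    apply: (mulfI (k0 (2 * j)%N)); rewrite -deS dS eS IH1 IH2 dj.
    by rewrite -(natr1 (2 * j)%N) /a natrM; ring.
  have eS2 : e (2 * j.+1)%N = 0.
    by rewrite mulnS eS g1 eS IH1 IH2; ring.
  split => //; apply: (mulfI (k0 (2 * j).+1%N)).
  have := deS (2 * j.+1)%N; rewrite eS2 addr0 mulnS dS g1 dS IH1 dj => <-.
  have -> : (2 * j)%N.+2%:R = 2 * j.+1%:R :> F by rewrite -natrM mulnS.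
  by rewrite -mulrA AS natrM; ring.
rewrite -{1}(odd_double_half n) -mul2n; case: (odd n) => /=; last first.
  by rewrite add0n (even _).1.
apply: (mulfI (k0 (2 * n./2)%N)); rewrite add1n -deS dS eS (even _).1 (even _).2.
rewrite -(addr0 (d _)) -{1}(even n./2).2 deS (even _).1 -(natr1 (2 * _)%N) /a.
ring.
Qed.

End RisingFactorial.

Section GammaFunction.
Variable R : realType.
Local Notation mu := lebesgue_measure.
Implicit Types a p q t : R.

Definition gammaf a t : R := t `^ (a - 1) * expR (- t).

Lemma gammaf_ge0 a t : 0 <= gammaf a t.
Proof. by rewrite mulr_ge0 ?powR_ge0 ?expR_ge0. Qed.

Lemma is_derive_NexpRN t : is_derive t 1 (fun t : R => - expR (- t)) (expR (- t)).
Proof.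
by apply: is_derive_eq; rewrite mulrN1 opprK. Qed.

Lemma continuous_gammaf a t : 0 < t -> {for t, continuous (gammaf a)}.
Proof.
move=> t0; apply/differentiable_continuous/derivable1_diffP/derivableM.
  by apply: ex_derive; exact: is_derive1_powR.
exact: ex_derive.
Qed.

Lemma measurable_gammaf (D : set R) a :
  measurable_fun D (fun t : R => (gammaf a t)%:E).
Proof.
apply/measurable_EFinP/measurable_funTS.
apply: measurable_funM; first exact: measurable_powR.
by apply: measurableT_comp => //; exact: measurable_expR.
Qed.

(** A compact subinterval of (0, +oo) avoids the singularity of t^(a-1) at 0; the boundary terms
    stay explicit and are sent to 0 afterwards. *)
Lemma gammaf_by_parts a p q : 0 < p -> p < q ->
  (\int[mu]_(t in `[p, q]) (gammaf (a + 1) t)%:E =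
   (p `^ a * expR (- p) - q `^ a * expR (- q))%:E +
   a%:E * \int[mu]_(t in `[p, q]) (gammaf a t)%:E)%E.
Proof.
move=> p0 pq.
have pos t : t \in `[p, q]%R -> 0 < t.
  by rewrite in_itv/= => /andP[pt _]; exact: lt_le_trans pt.
have dcont (F : R -> R) (f : R -> R) :
    (forall t, 0 < t -> is_derive t 1 F (f t)) -> 
    derivable_oo_LRcontinuous F p q /\ {in `]p, q[, F^`()%classic =1 f}.
  move=> dF; have cF t : 0 < t -> {for t, continuous F}.
    by move=> /dF [dt _]; apply/differentiable_continuous/derivable1_diffP.
  split; first split.
  - by move=> t tpq; apply: ex_derive; apply/dF/pos/subset_itv_oo_cc.
  - by apply: cvg_at_right_filter; exact: cF.
  - by apply: cvg_at_left_filter; apply: cF; exact: lt_trans pq.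
  - move=> t tpq; rewrite derive1E; apply: derive_val.
    by apply/dF/pos/subset_itv_oo_cc.
have [dF F'] := dcont _ _ (fun t => @is_derive1_powR R a t).
have [dG G'] := dcont _ _ (fun t _ => is_derive_NexpRN t).
have cw (f : R -> R) : (forall t, 0 < t -> {for t, continuous f}) ->
    {within `[p, q], continuous f}.
  by move=> cf; apply: continuous_in_subspaceT => t /[1!inE] /pos; exact: cf.
have cf : {within `[p, q], continuous (fun t => a * t `^ (a - 1))}.
  apply: cw => t t0; apply/differentiable_continuous/derivable1_diffP.
  apply: derivableM => //; apply: ex_derive; exact: is_derive1_powR.
have cg : {within `[p, q], continuous (fun t : R => expR (- t))}.
  apply: cw => t t0; apply/differentiable_continuous/derivable1_diffP.
  exact: ex_derive.
have := integration_by_parts pq cf dF F' cg dG G'.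
under eq_integral do rewrite -{1}(addrK 1 a).
move=> ->; congr (_ + _)%E; first by congr EFin; ring.
rewrite -integralZl//; last first.
  apply: (@continuous_compact_integrable _ (gammaf a)).
    exact: segment_compact.
  by apply: cw => t; exact: continuous_gammaf.
rewrite -integralN/=; last first.
  apply: integrable_add_def; first exact: measurable_itv.
  apply: (@continuous_compact_integrable _
    (fun t => a * t `^ (a - 1) * - expR (- t))); first exact: segment_compact.
  apply: cw => t t0; apply: differentiable_continuous; apply/derivable1_diffP.
  apply: derivableM; last exact: ex_derive.
  by apply: derivableM => //; apply: ex_derive; exact: is_derive1_powR.
apply: eq_integral => t _; rewrite -EFinM /gammaf; congr EFin; ring.
Qed.

(** Kept in the extended reals: the functional equation is obtained as a limit without knowing
    finiteness, and then serves to prove finiteness. *)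
Definition gammae a : \bar R := (\int[mu]_(t in `]0%R, +oo[) (gammaf a t)%:E)%E.


(** For an integer N above |a|, e^t >= t^(N+1) / (N+1)! bounds the term at t = n + 2 by (N+1)! /
    t. *)
Lemma cvg_powR_expRN a : (n.+2%:R `^ a * expR (- n.+2%:R)) @[n --> \oo] --> (0 : R).
Proof.
pose N := (Num.truncn `|a|).+1.
have aN : a <= N%:R.
  by apply: le_trans (ler_norm a) _; apply/ltW; exact: truncnS_gt.
apply: (@squeeze_cvgr _ _ _ _ (fun=> 0) (fun n => N.+1`!%:R * @harmonic R n.+1)).
- apply: nearW => n; have n0 : 0 < n.+2%:R :> R by rewrite ltr0n.
  rewrite mulr_ge0 ?powR_ge0 ?expR_ge0//=.
  have h1 : n.+2%:R `^ a <= n.+2%:R ^+ N :> R.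
    by rewrite -powR_mulrn ?ler_powR ?ler1n// ltW.
  have h2 : n.+2%:R ^+ N.+1 / N.+1`!%:R <= expR n.+2%:R :> R.
    by apply: le_trans (expR_ge1Dxn N (ltW n0)); rewrite lerDr ler01.
  rewrite /harmonic expRN ler_pdivrMr ?expR_gt0//.
  apply: (le_trans h1); rewrite -(ler_pM2l n0) mulrA mulrA [_ * _ * _^-1]mulrAC.
  rewrite divff ?gt_eqF// mul1r -exprS mulrC -ler_pdivrMr ?ltr0n ?fact_gt0//.
- exact: cvg_cst.
- rewrite -(mulr0 N.+1`!%:R); apply: cvgMl_tmp.
  by rewrite (cvg_shiftS (@harmonic R)); exact: cvg_harmonic.
Qed.

Lemma cvg_powR_inv_expRN a : 0 < a ->
  (n.+2%:R^-1 `^ a * expR (- n.+2%:R^-1)) @[n --> \oo] --> (0 : R).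
Proof.
move=> a0; have p0 n : 0 < n.+2%:R^-1 :> R by rewrite invr_gt0 ltr0n.
apply: (@squeeze_cvgr _ _ _ _ (fun=> 0) (fun n => n.+2%:R^-1 `^ a)).
- apply: nearW => n; rewrite mulr_ge0 ?powR_ge0 ?expR_ge0//=.
  by rewrite ler_piMr ?powR_ge0// expR_le1 oppr_le0 ltW.
- exact: cvg_cst.
- have /cvg_at_rightP := powR_cvg0 a0; apply; split => //.
  by rewrite (cvg_shiftS (@harmonic R)); exact: cvg_harmonic.
Qed.

(** Monotone convergence along intervals exhausting (0, +oo). The shift by 2 keeps [1/(n+2), n+2]
    nondegenerate for n = 0, as integration by parts requires. *)
Lemma cvg_gammae a :
  (\int[mu]_(t in `[n.+2%:R^-1%R, n.+2%:R%R]) (gammaf a t)%:E)%E @[n --> \oo]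
    --> gammae a.
Proof.
have -> : gammae a = (\int[mu]_(t in \bigcup_n `[n.+2%:R^-1%R, n.+2%:R%R]%classic)
    (gammaf a t)%:E)%E.
  congr (integral _ _ _); apply/seteqP; split => t /=; rewrite in_itv/= ?andbT.
    move=> t0; pose n := Num.truncn (t + t^-1).
    have tn : t + t^-1 < n.+2%:R.
      by apply: lt_trans (truncnS_gt _) _; rewrite ltr_nat.
    exists n => //=; rewrite in_itv/=; apply/andP; split.
      rewrite invf_ple ?posrE ?ltr0n//; apply/ltW; apply: le_lt_trans tn.
      by rewrite lerDr ltW.
    by apply/ltW; apply: le_lt_trans tn; rewrite lerDl invr_ge0 ltW.
  move=> [n _ /=]; rewrite in_itv/= => /andP[+ _]; apply: lt_le_trans.
  by rewrite invr_gt0 ltr0n.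
apply: ge0_nondecreasing_set_cvg_integral => //.
- move=> n k nk; apply/subsetPset => t /=; rewrite !in_itv/= => /andP[h1 h2].
  rewrite (le_trans _ h1) ?(le_trans h2) ?ler_nat ?ltnS//.
  by rewrite lef_pV2 ?posrE ?ltr0n// ler_nat.
- by move=> n; exact: measurable_gammaf.
- by move=> n t _; rewrite lee_fin gammaf_ge0.
Qed.

Lemma gammaeD1 a : 0 < a -> gammae (a + 1) = (a%:E * gammae a)%E.
Proof.
move=> a0; rewrite -[RHS]add0e.
rewrite -(cvg_lim (@ereal_hausdorff R) (@cvg_gammae (a + 1))).
apply/cvg_lim; first exact: ereal_hausdorff.
have -> : (fun n : nat =>
    \int[mu]_(t in `[n.+2%:R^-1%R, n.+2%:R%R]) (gammaf (a + 1) t)%:E)%E =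
  ((EFin \o (fun n => (n.+2%:R^-1 `^ a * expR (- n.+2%:R^-1) -
     n.+2%:R `^ a * expR (- n.+2%:R))%R)) \+ (fun n : nat =>
     a%:E * \int[mu]_(t in `[n.+2%:R^-1%R, n.+2%:R%R]) (gammaf a t)%:E))%E.
  apply/funext => n /=; rewrite gammaf_by_parts ?invr_gt0 ?ltr0n//.
  by rewrite (@lt_trans _ _ 1)// ?invf_lt1 ?ltr0n ?ltr1n.
apply: cvgeD => //; last by apply: cvgeZl => //; exact: cvg_gammae.
apply: cvg_EFin; first exact: nearW.
have := cvgB (cvg_powR_inv_expRN a0) (cvg_powR_expRN a).
by rewrite subrr; exact.
Qed.

Lemma gammae1 : gammae 1 = 1%E.
Proof.
rewrite /gammae -(integral_exponential_pdf (@ltr01 R)).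
rewrite integral_itv_obnd_cbnd; last exact: measurable_gammaf.
rewrite [RHS](_ : _ = \int[mu]_(x in `[0%R, +oo[) (expR (- x))%:E)%E.
  apply: eq_integral => t; rewrite inE/= in_itv/= andbT => t0.
  by rewrite /gammaf subrr powRr0 mul1r.
rewrite [RHS]integral_mkcond; apply: eq_integral => t _.
rewrite /exponential_pdf !patchE; case: ifP => // _.
by rewrite mul1r mulN1r.
Qed.

Lemma gammae_ge0 a : (0 <= gammae a)%E.
Proof. by apply: integral_ge0 => t _; rewrite lee_fin gammaf_ge0. Qed.

(** The functional equation transports finiteness in both directions, which reduces the claim to 0 <
    b <= 1. There t^b <= 1 + t bounds the value at b + 1 by the sum of the values at 1 and 2, so the
    singularity at 0 is never integrated directly. *)
Lemma gammae_fin a : 0 < a -> gammae a \is a fin_num.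
Proof.
have gD b : 0 < b -> (gammae (b + 1) \is a fin_num) = (gammae b \is a fin_num).
  move=> b0; rewrite gammaeD1//; have := gammae_ge0 b.
  case: (gammae b) => [r| |]//= _; by rewrite gt0_muley ?lte_fin.
have base b : 0 < b -> b <= 1 -> gammae b \is a fin_num.
  move=> b0 b1; rewrite -gD//.
  have g2 : gammae 2 = 1%E.
    by rewrite (_ : 2 = 1 + 1)// gammaeD1// gammae1 mule1.
  rewrite ge0_fin_numE ?gammae_ge0//; apply: (@le_lt_trans _ _ (gammae 1 + gammae 2)%E).
    rewrite -ge0_integralD//; [|by move=> t _; rewrite lee_fin gammaf_ge0
      |exact: measurable_gammaf|by move=> t _; rewrite lee_fin gammaf_ge0
      |exact: measurable_gammaf].
    apply: ge0_le_integral => //; [by move=> t _; rewrite lee_fin gammaf_ge0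
      |exact: measurable_gammaf| | ].
      by apply: emeasurable_funD; exact: measurable_gammaf.
    move=> t /=; rewrite in_itv/= andbT => t0; rewrite lee_fin -mulrDl.
    rewrite ler_wpM2r ?expR_ge0// addrK subrr powRr0.
    rewrite (_ : 2 - 1 = 1); last by ring.
    rewrite powRr1 ?(ltW t0)//; have [t1|/ltW t1] := leP t 1.
      apply: (@le_trans _ _ 1); last by rewrite lerDl ltW.
      by rewrite -(powRr0 t) ger_powR ?t0 ?t1// ltW.
    apply: (@le_trans _ _ t); last by rewrite lerDr.
    exact: ler1_powR.
  by rewrite g2 gammae1 -EFinD ltry.
move=> a0; have [n] : exists n : nat, a <= n.+1%:R.
  by exists (Num.truncn a); apply/ltW; exact: truncnS_gt.
elim: n a a0 => [|n IH] a a0; first exact: base.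
have [a1 _|a1 an] := leP a 1; first exact: base.
rewrite -(subrK 1 a) gD ?subr_gt0//; apply: IH; first by rewrite subr_gt0.
by rewrite lerBlDr natr1.
Qed.

Lemma gammae_gt0 a : 0 < a -> (0 < gammae a)%E.
Proof.
(* A lower bound of the integrand on [1, 2]: t^(a-1) is monotone, so its minimum is at an endpoint
   that depends on the sign of a - 1. *)
move=> a0; pose c := Num.min (1 `^ (a - 1)) (2 `^ (a - 1)) * expR (- 2) : R.
have c0 : 0 < c by rewrite mulr_gt0 ?expR_gt0// lt_min !powR_gt0.
apply: (@lt_le_trans _ _ (\int[mu]_(t in `[1%R, 2%R]) (c%:E))%E).
  rewrite integral_cst//= lebesgue_measure_itv/= lte_fin ltr1n/=.
  by rewrite -EFinD -EFinM lte_fin mulr_gt0// subr_gt0 ltr1n.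
apply: (@le_trans _ _ (\int[mu]_(t in `[1%R, 2%R]) (gammaf a t)%:E)%E).
  apply: ge0_le_integral => //.
  - by move=> t _; rewrite lee_fin ltW.
  - exact: measurable_gammaf.
  - move=> t /=; rewrite in_itv/= => /andP[t1 t2]; rewrite lee_fin.
    have t0 : 0 < (t : R) := lt_le_trans ltr01 t1.
    apply: ler_pM; rewrite ?expR_ge0 ?ler_expR ?lerN2//.
    have [h|h] := leP 0 (a - 1).
      rewrite ge_min; apply/orP; left.
      by apply: ge0_ler_powR => //; rewrite nnegrE ltW.
    rewrite ge_min; apply/orP; right.
    rewrite -[a - 1]opprK 2!(powRN _ (- (a - 1))) lef_pV2 ?posrE ?powR_gt0//.
    by apply: ge0_ler_powR => //; rewrite ?nnegrE ?oppr_ge0 ltW.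
apply: ge0_subset_integral => //.
- exact: measurable_gammaf.
- by move=> t _; rewrite lee_fin gammaf_ge0.
- move=> t /=; rewrite !in_itv/= => /andP[t1 _]; by rewrite (lt_le_trans _ t1).
Qed.

Lemma GammaE a : Gamma a = fine (gammae a).
Proof. by []. Qed.

Lemma GammaD1 a : 0 < a -> Gamma (a + 1) = a * Gamma a.
Proof.
move=> a0; rewrite !GammaE gammaeD1// fineM//; exact: gammae_fin.
Qed.

Lemma Gamma_gt0 a : 0 < a -> 0 < Gamma a.
Proof.
move=> a0; rewrite GammaE fine_gt0// gammae_gt0//=.
by rewrite -ge0_fin_numE ?gammae_ge0// gammae_fin.
Qed.

Lemma GammaDn a n : 0 < a -> Gamma (a + n%:R) = rising a n * Gamma a.
Proof.
move=> a0; elim: n => [|n IH]; first by rewrite rising0 addr0 mul1r.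
have an0 : 0 < a + n%:R by rewrite ltr_wpDr.
by rewrite -[n.+1%:R]natr1 addrA (GammaD1 an0) IH risingS mulrA [(a + _) * _]mulrC.
Qed.

(** The case a = 0, reached by (m - 1)/2 when m = 1, agrees with the limiting value chosen in [poch]
    because the product then contains the factor 0 as soon as n > 0. *)
Lemma pochE a n : 0 <= a -> poch a n = rising a n.
Proof.
rewrite /poch le_eqVlt => /predU1P[<-|a0].
  by rewrite eqxx; case: n => [|n]; rewrite ?rising0// risingSl mul0r.
by rewrite gt_eqF// GammaDn// mulfK// gt_eqF// Gamma_gt0.
Qed.

End GammaFunction.

(** * Clifford-Appell polynomials *)

Lemma appell_coef (R : numFieldType) (L : comUnitAlgType R) (T : nat -> {poly L}) :
  (T 0)^`() = 0 -> (forall k, (T k.+1)^`() = k.+1%:R *: T k) ->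
  forall k i, (T k)`_i = 'C(k, i)%:R * (T (k - i)%N)`_0.
Proof.
(* Comparing coefficients gives an identity multiplied by i + 1; in the algebra [L] this factor is
   cancelled through its inverse in the scalar field. *)
move=> T0 TS; have inj i : injective ( *%R (i.+1%:R : L)).
  have e (c : L) : i.+1%:R * c = (i.+1%:R : R) *: c.
    by rewrite mulr_natl scaler_nat.
  move=> c d; rewrite !e => /(congr1 ( *:%R (i.+1%:R : R)^-1)).
  by rewrite !scalerA mulVf ?pnatr_eq0// !scale1r.
elim=> [|k IH] [|i]; rewrite ?bin0 ?mul1r ?subn0//.
  rewrite bin0n mul0r; apply: (@inj i); rewrite mulr0 mulr_natl -coef_deriv.
  by rewrite T0 coef0.
apply: (@inj i); rewrite mulr_natl -coef_deriv TS coefZ IH subSS !mulrA.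
congr (_ * _); by rewrite -!natrM mul_bin_diag.
Qed.

Section AppellPolynomial.
Variable R : realType.
Variables a b : R.
Hypotheses (a0 : 0 <= a) (b0 : 0 <= b) (ab0 : 0 < a + b).

(* ['X] stands for the scalar part x0 and the inner variable ['X%:P] for the
   vector part. *)
Definition appell_poly k : {poly {poly R}} :=
  \sum_(s < k.+1)
    (('C(k, s)%:R * (rising a (k - s) * rising b s / rising (a + b) k))%:P)%:P
      * (('X + 'X%:P) ^+ (k - s) * ('X - 'X%:P) ^+ s).

(** With Z = x0 + y and W = x0 - y, the monomial Z^(k-s) W^s arises from the terms s and s + 1 of
    the sum. Their weights add up through (a + k - s) + (b + s) = a + b + k, which cancels the last
    factor of (a + b)_(k+1). *)
Lemma deriv_appell_poly k : (appell_poly k.+1)^`() = k.+1%:R *: appell_poly k.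
Proof.
pose Z : {poly {poly R}} := 'X + 'X%:P; pose W : {poly {poly R}} := 'X - 'X%:P.
have Z' : Z^`() = 1 by rewrite derivD derivX derivC addr0.
have W' : W^`() = 1 by rewrite derivB derivX derivC subr0.
pose C (c : R) : {poly {poly R}} := (c%:P)%:P.
pose t (k s : nat) := 'C(k, s)%:R * (rising a (k - s) * rising b s / rising (a + b) k).
pose P i j := Z ^+ i * W ^+ j.
have -> : appell_poly k = \sum_(s < k.+1) C (t k s) * P (k - s)%N s by [].
have -> : appell_poly k.+1 = \sum_(s < k.+2) C (t k.+1 s) * P (k.+1 - s)%N s by [].
rewrite raddf_sum/=.
under eq_bigr => s _.
  rewrite derivM !derivC mul0r add0r derivM !deriv_exp Z' W' !mul1r mulrDr.
  over.
rewrite big_split/= big_ord_recr/= subnn mulr0n mul0r mulr0 addr0.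
rewrite [X in _ + X]big_ord_recl/= mulr0n !mulr0 add0r -big_split/= scaler_sumr.
apply: eq_bigr => s _; rewrite /bump/= add1n subSS.
rewrite subSn ?leq_ord//= -/(P _ _).
rewrite mulrnAl !mulrnAr -mulrnAl -[X in _ + X]mulrnAl -mulrDl.
rewrite scaler_nat -mulrnAl; congr (_ * _).
rewrite /C -!polyCMn -!polyCD -(mulr_natr (t k.+1 s))
  -(mulr_natr (t k.+1 s.+1)) -(mulr_natr (t k s)); congr (_%:P%:P).
have sk := leq_ord s.
have tS : 'C(k.+1, s)%:R * (k - s).+1%:R = k.+1%:R * 'C(k, s)%:R :> R.
  by rewrite -!natrM mul_bin_down -subSn// mulnC.
have tS' : 'C(k.+1, s.+1)%:R * s.+1%:R = k.+1%:R * 'C(k, s)%:R :> R.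
  by rewrite -!natrM mul_bin_diag mulnC.
rewrite /t subSn// subSS mulrAC tS [in X in _ + X]mulrAC tS' !risingS natrB//.
have abk : a + b + k%:R != 0 by rewrite gt_eqF// ltr_wpDr.
have abr : rising (a + b) k != 0 by rewrite gt_eqF// rising_gt0.
by field; rewrite abk abr.
Qed.

Lemma appell_poly_const k : (appell_poly k)`_0 =
  (k`!%:R * altconv a b k / rising (a + b) k)%:P * 'X^k.
Proof.
rewrite -horner_coef0 /appell_poly horner_sum.
under eq_bigr => s _.
  rewrite hornerM hornerC hornerM !horner_exp !hornerD hornerN !hornerX !hornerC.
  rewrite add0r sub0r exprNn [X in _ * X]mulrCA -exprD subnK ?leq_ord//.
  over.
rewrite /altconv mulr_sumr mulr_suml raddf_sum mulr_suml; apply: eq_bigr => s _ /=.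
rewrite [LHS]mulrA; congr (_ * _).
rewrite -polyC1 -polyCN -polyC_exp -polyCM; congr _%:P.
rewrite -(bin_fact (leq_ord s)) !natrM.
have f0 n : n`!%:R != 0 :> R by rewrite pnatr_eq0 -lt0n fact_gt0.
have abr : rising (a + b) k != 0 by rewrite gt_eqF// rising_gt0.
by field; rewrite abr !f0.
Qed.

Lemma appell_polyE k : appell_poly k = \sum_(n < k.+1)
  ('C(k, n)%:R * (n`!%:R * altconv a b n / rising (a + b) n))%:P%:P
    * ('X%:P ^+ n * 'X ^+ (k - n)).
Proof.
have app0 : (appell_poly 0)^`() = 0.
  by rewrite /appell_poly big_ord1 !subnn !expr0 !mulr1 derivC.
have coefE i : (appell_poly k)`_i = 'C(k, i)%:R *
    ((k - i)`!%:R * altconv a b (k - i) / rising (a + b) (k - i))%:P * 'X^(k - i).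
  by rewrite (appell_coef app0 deriv_appell_poly) appell_poly_const mulrA.
have size_k : (size (appell_poly k) <= k.+1)%N.
  apply/leq_sizeP => i ki; by rewrite coefE bin_small// !mul0r.
rewrite -(take_poly_id size_k) /take_poly poly_def (reindex_inj rev_ord_inj)/=.
apply: eq_bigr => n _; have nk := leq_ord n.
rewrite subSS coefE subKn// bin_sub// -mul_polyC !polyCM polyC_exp !mulrA.
by rewrite !rmorph_nat.
Qed.

End AppellPolynomial.

(** * Evaluation in the Clifford algebra, scalar and vector parts *)

Section CliffordEvaluation.
Variables (R : realType) (m : nat).
Local Notation C := (clifford R m).
Implicit Types x : 'rV[R]_m.+1.

(** The square of [vnorm], used in its place because it is polynomial, hence smooth also where the
    vector part vanishes. *)
Definition rho x : R := \sum_(j < m) x 0 (lift ord0 j) ^+ 2.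

Lemma vpart_sqr x : vpart x * vpart x = (- rho x)%:A.
Proof.
have dbl (c : C) : c + c = 2 *: c by rewrite scaler_nat mulr2n.
have inj2 (c d : C) : 2 *: c = 2 *: d -> c = d.
  move=> /(congr1 ( *:%R (2^-1 : R))); rewrite !scalerA mulVf ?pnatr_eq0//.
  by rewrite !scale1r.
apply: inj2; rewrite -dbl.
have vv : vpart x * vpart x = \sum_(i < m) \sum_(j < m)
    (x 0 (lift ord0 i) * x 0 (lift ord0 j)) *: (egen R i * egen R j).
  rewrite /vpart mulr_suml; apply: eq_bigr => i _; rewrite mulr_sumr.
  by apply: eq_bigr => j _; rewrite -scalerAl -scalerAr scalerA.
(* The double sum is added to itself with i and j exchanged, so that the terms pair into
   anticommutators, of which only the diagonal ones survive. *)
rewrite {1}vv exchange_big/= vv -big_split/= scalerA.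
rewrite (eq_bigr (fun i => (-2 * x 0 (lift ord0 i) ^+ 2) *: (1 : C))).
  by rewrite -scaler_suml -mulr_sumr mulrN -mulNr.
move=> i _; rewrite -big_split/= (bigD1 i)//= big1 ?addr0 => [|j ji].
  by rewrite -scalerDr egen_anticomm eqxx mulr1 scalerA mulrC expr2.
rewrite (mulrC (x _ _)) -scalerDr egen_anticomm (negbTE ji) mulr0 scale0r.
by rewrite scaler0.
Qed.

Lemma vpart_exp x n :
  vpart x ^+ n = (- rho x) ^+ n./2 *: (if odd n then vpart x else 1).
Proof.
rewrite -{1}(odd_double_half n) exprD -mul2n exprM expr2 vpart_sqr.
rewrite exprZn expr1n -scalerAr mulr1.
by case: (odd n); rewrite ?expr1 ?expr0.
Qed.

Lemma gradeD p (c d : C) : grade p (c + d) = grade p c + grade p d.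
Proof.
by rewrite /grade -big_split; apply: eq_bigr => A _; rewrite Defs.coefD scalerDl.
Qed.

Lemma gradeZ p k (c : C) : grade p (k *: c) = k *: grade p c.
Proof.
by rewrite /grade scaler_sumr; apply: eq_bigr => A _; rewrite Defs.coefZ scalerA.
Qed.

Lemma grade_sum p (I : Type) (r : seq I) (P : pred I) (E : I -> C) :
  grade p (\sum_(i <- r | P i) E i) = \sum_(i <- r | P i) grade p (E i).
Proof.
apply: (big_morph _ (gradeD p)); rewrite /grade big1// => A _.
by rewrite /coef mxE scale0r.
Qed.

Lemma grade_ebasis p (A : {set 'I_m}) :
  grade p (ebasis R A : C) = if #|A| == p then ebasis R A else 0.
Proof.
rewrite /grade big_mkcond (bigD1 A)//= big1 ?addr0 => [|B BA].
  by rewrite Defs.coefK eqxx scale1r.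
by rewrite Defs.coefK (negbTE BA) scale0r if_same.
Qed.

Lemma grade_vpart p x : grade p (vpart x) = if p == 1%N then vpart x else 0.
Proof.
rewrite /vpart grade_sum (eq_bigr (fun j => if p == 1%N then
  x 0 (lift ord0 j) *: egen R j else 0)).
  by case: eqP => // _; rewrite big1.
move=> j _; rewrite gradeZ grade_ebasis cards1 eq_sym.
by case: eqP; rewrite ?scaler0.
Qed.

Lemma grade_one p : grade p (1 : C) = if p == 0%N then 1 else 0.
Proof. by rewrite grade_ebasis cards0 eq_sym. Qed.

Lemma sum_even (V : nmodType) (E : nat -> V) k :
  \sum_(n < k.+1) (if odd n then 0 else E n./2) = \sum_(j < k./2.+1) E j.
Proof.
elim: k => [|k IH]; first by rewrite !big_ord1.
rewrite big_ord_recr/= IH uphalf_half; case: (odd k) => /=.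
  by rewrite [RHS]big_ord_recr.
by rewrite addr0.
Qed.

Lemma sum_odd (V : nmodType) (E : nat -> V) k :
  \sum_(n < k.+2) (if odd n then E n./2 else 0) = \sum_(j < k./2.+1) E j.
Proof.
rewrite big_ord_recl/= add0r -(sum_even E k); apply: eq_bigr => n _.
by rewrite /bump/= uphalf_half; case: (odd n).
Qed.

(** Homogeneous of degree k when [u] has weight 1 and [w], standing for |x_|^2, has weight 2. *)
Definition axial_poly (c : nat -> R) (k : nat) (u w : R) : R :=
  \sum_(j < k./2.+1) c j * u ^+ (k - 2 * j) * w ^+ j.

(* For l = m / 2 and l = m / 2 + 1 these are the coefficients of H_k^0 and H_k^1. *)
Definition hgck_coef (l : R) (k j : nat) : R :=
  (-1) ^+ j * (k ^_ (2 * j))%:R / (4 ^+ j * j`!%:R * rising l j).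

Hypothesis m_gt0 : (0 < m)%N.

(** At x0 = 0 the Clifford-Appell polynomial of degree n is this number times x_^n. *)
Definition appell_value n : R :=
  n`!%:R * altconv ((m%:R + 1) / 2) ((m%:R - 1) / 2) n / rising m%:R n.

(** The identity is transported from commutative bivariate polynomials by the morphism sending the
    inner variable to [vpart x] and the outer one to the scalar x0; this is a morphism because
    scalars are central. *)
Lemma clifford_appellE k x : clifford_appell k x =
  \sum_(n < k.+1) ('C(k, n)%:R * appell_value n * x0of x ^+ (k - n))
    *: vpart x ^+ n.
Proof.
pose a : R := (m%:R + 1) / 2; pose b : R := (m%:R - 1) / 2.
have a0 : 0 <= a by rewrite divr_ge0 ?addr_ge0.
have b0 : 0 <= b by rewrite divr_ge0 ?subr_ge0 ?ler1n.
have ab : a + b = m%:R by rewrite /a /b; field.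
have ab0 : 0 < a + b by rewrite ab ltr0n.
pose f : {rmorphism {poly R} -> C} := horner_alg (vpart x).
have cfu : commr_rmorph f ((x0of x)%:A : C).
  by move=> p; rewrite /GRing.comm -scalerAl -scalerAr mul1r mulr1.
pose phi : {rmorphism {poly {poly R}} -> C} := horner_morph cfu.
have phiC c : phi c%:P%:P = c%:A by rewrite /phi/= horner_morphC; exact: horner_algC.
have phiY : phi 'X%:P = vpart x by rewrite /phi/= horner_morphC; exact: horner_algX.
have phiX : phi 'X = (x0of x)%:A by rewrite /phi/= horner_morphX.
transitivity (phi (appell_poly a b k)).
  rewrite /appell_poly rmorph_sum; apply: eq_bigr => s _.
  rewrite (rmorphM phi) phiC (rmorphM phi) !(rmorphXn phi) (rmorphD phi).
  by rewrite (rmorphB phi) phiX phiY mulr_algl ab !pochE.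
rewrite appell_polyE// rmorph_sum; apply: eq_bigr => n _.
rewrite (rmorphM phi) phiC (rmorphM phi) !(rmorphXn phi) phiX phiY ab.
by rewrite exprZn expr1n mulr_algl mulr_algr scalerA.
Qed.

Lemma appell_valueE n : appell_value n =
  n`!%:R * rising ((m%:R + 1) / 2) n./2 / (n./2`!%:R * rising m%:R n).
Proof.
rewrite /appell_value.
have -> : (m%:R + 1) / 2 = (m%:R - 1) / 2 + 1 :> R by field.
by rewrite altconvE invfM !mulrA.
Qed.

(** By duplication (m)_(2j) = 4^j (m/2)_j ((m+1)/2)_j, and the last factor cancels the one coming
    from [altconvE]. *)
Lemma appell_value_even k j : (2 * j <= k)%N ->
  'C(k, 2 * j)%:R * appell_value (2 * j) * (-1) ^+ j = hgck_coef (m%:R / 2) k j.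
Proof.
move=> jk; rewrite appell_valueE mul2n doubleK -mul2n /hgck_coef rising_double.
have <- : ('C(k, 2 * j) * (2 * j)`!)%N = (k ^_ (2 * j))%N by rewrite bin_ffact.
have f0 n : n`!%:R != 0 :> R by rewrite pnatr_eq0 -lt0n fact_gt0.
have m0 : 0 < m%:R :> R by rewrite ltr0n.
have r1 : rising (m%:R / 2 : R) j != 0 by rewrite gt_eqF// rising_gt0// divr_gt0.
have r2 : rising ((m%:R + 1) / 2 : R) j != 0.
  by rewrite gt_eqF// rising_gt0// divr_gt0// addr_gt0.
have e4 : 4 ^+ j != 0 :> R by rewrite expf_neq0// pnatr_eq0.
by rewrite natrM; field; rewrite f0 r1 r2 e4.
Qed.

(** Here (m)_(2j+1) = m (m+1)_(2j) = m 4^j ((m+1)/2)_j (m/2+1)_j. The leftover m, and the k + 1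
    contained in the binomial coefficient, account for the normalization m/(k+1). *)
Lemma appell_value_odd k j : (2 * j <= k)%N ->
  m%:R / k.+1%:R * ('C(k.+1, (2 * j).+1)%:R * appell_value (2 * j).+1 * (-1) ^+ j)
    = hgck_coef (m%:R / 2 + 1) k j.
Proof.
move=> jk; rewrite appell_valueE /= uphalf_half mul2n odd_double doubleK -mul2n.
rewrite add0n /hgck_coef risingSl rising_double.
have e : ('C(k.+1, (2 * j).+1) * (2 * j).+1`!)%N = (k.+1 * k ^_ (2 * j))%N.
  by rewrite bin_ffact.
have f0 n : n`!%:R != 0 :> R by rewrite pnatr_eq0 -lt0n fact_gt0.
have m0 : 0 < m%:R :> R by rewrite ltr0n.
have -> : (m%:R + 1 + 1) / 2 = m%:R / 2 + 1 :> R by field.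
have r1 : rising (m%:R / 2 + 1 : R) j != 0.
  by rewrite gt_eqF// rising_gt0// addr_gt0// divr_gt0.
have r2 : rising ((m%:R + 1) / 2 : R) j != 0.
  by rewrite gt_eqF// rising_gt0// divr_gt0// addr_gt0.
have e4 : 4 ^+ j != 0 :> R by rewrite expf_neq0// pnatr_eq0.
have k0 : k.+1%:R != 0 :> R by rewrite pnatr_eq0.
have {}e : (k ^_ (2 * j))%:R =
    'C(k.+1, (2 * j).+1)%:R * (2 * j).+1`!%:R / k.+1%:R :> R.
  by rewrite -natrM e natrM mulrC mulKf.
rewrite e.
by field; rewrite f0 r1 r2 e4 nat1r k0 gt_eqF.
Qed.

(** Even powers of x_ are scalars and odd powers are scalar multiples of x_, so the scalar part
    keeps exactly the indices n = 2j, and x_^(2j) contributes the sign (-1)^j. *)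
Lemma grade0_clifford_appell k x : grade 0 (clifford_appell k x) =
  (axial_poly (hgck_coef (m%:R / 2) k) k (x0of x) (rho x))%:A.
Proof.
rewrite clifford_appellE grade_sum /axial_poly scaler_suml.
pose t n : R := 'C(k, n)%:R * appell_value n * x0of x ^+ (k - n) * (- rho x) ^+ n./2.
transitivity (\sum_(n < k.+1) (if odd n then 0 else t (2 * n./2)%N *: 1 : C)).
  apply: eq_bigr => n _; rewrite gradeZ vpart_exp gradeZ scalerA.
  case: ifP => on; first by rewrite grade_vpart scaler0.
  by rewrite grade_one/= mul2n halfK on subn0.
rewrite (sum_even (fun j => t (2 * j)%N *: 1)); apply: eq_bigr => j _.
have jk : (2 * j <= k)%N by rewrite mul2n -geq_half_double leq_ord.
rewrite -appell_value_even// /t mul2n doubleK -mul2n (exprNn (rho x)).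
by congr (_ *: _); ring.
Qed.

Lemma grade1_clifford_appell k x :
  (m%:R / k.+1%:R) *: grade 1 (clifford_appell k.+1 x) =
  axial_poly (hgck_coef (m%:R / 2 + 1) k) k (x0of x) (rho x) *: vpart x.
Proof.
rewrite clifford_appellE grade_sum /axial_poly scaler_suml scaler_sumr.
pose t n : R := m%:R / k.+1%:R *
  ('C(k.+1, n)%:R * appell_value n * x0of x ^+ (k.+1 - n) * (- rho x) ^+ n./2).
transitivity (\sum_(n < k.+2)
    (if odd n then t (2 * n./2).+1%N *: vpart x else 0 : C)).
  apply: eq_bigr => n _; rewrite gradeZ vpart_exp gradeZ !scalerA.
  case: ifP => on; last by rewrite grade_one scaler0.
  by rewrite grade_vpart/= mul2n halfK on subn1 prednK ?odd_gt0// /t !mulrA.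
rewrite (sum_odd (fun j => t (2 * j).+1%N *: vpart x)); apply: eq_bigr => j _.
have jk : (2 * j <= k)%N by rewrite mul2n -geq_half_double leq_ord.
rewrite -appell_value_odd// /t subSS /= uphalf_half mul2n odd_double doubleK.
rewrite add0n -mul2n (exprNn (rho x)).
by congr (_ *: _); ring.
Qed.

End CliffordEvaluation.

Lemma is_derive_scalel (R : numFieldType) (V W : normedModType R)
    (f : V -> R) (a : W) x v (df : R) :
  is_derive x v f df -> is_derive x v (fun y => f y *: a) (df *: a).
Proof.
move=> [dfx <-]; have h : (fun h => h^-1 *: (((fun y => f y *: a) \o shift x) (h *: v)
    - f x *: a)) @ 0^' --> 'D_v f x *: a.
  rewrite [X in X @ _](_ : _ = (fun h => (h^-1 *: ((f \o shift x) (h *: v) - f x)) *: a)).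
    by apply: cvgZr_tmp; exact: dfx.
  by apply/funext => h /=; rewrite -scalerBl scalerA.
by apply: DeriveDef; [exact: cvgP h|exact: cvg_lim h].
Qed.

Lemma cvg_series_finite (K : numFieldType) (V : normedModType K) (u : nat -> V) N :
  (forall j, (N <= j)%N -> u j = 0) -> series u @ \oo --> \sum_(j < N) u j.
Proof.
move=> u0; apply: cvg_near_cst; near=> n.
have Nn : (N <= n)%N by near: n; exact: nbhs_infty_ge.
rewrite /series/= (@big_cat_nat _ _ _ N)//= [X in _ + X]big_nat_cond.
rewrite [X in _ + X]big1 ?addr0; last by move=> i /andP[/andP[/u0]].
by rewrite big_mkord.
Unshelve. all: by end_near. Qed.

(** * Explicit form of the HGCK extensions *)

Section ExplicitForm.
Variables (R : realType) (m : nat).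
Hypothesis m_gt0 : (0 < m)%N.
Local Notation C := (clifford R m).
Implicit Types x : 'rV[R]_m.+1.

Lemma derive1n_exp k n : derive1n n (fun t : R => (t ^+ k)%:A : C) =
  fun t => ((k ^_ n)%:R * t ^+ (k - n))%:A.
Proof.
elim: n => [|n IH]; first by apply/funext => t /=; rewrite ffactn0 mul1r subn0.
rewrite derive1nS IH; apply/funext => t; rewrite derive1E.
apply: derive_val; apply: is_derive_scalel.
pose p : {poly R} := (k ^_ n)%:R *: 'X^(k - n).
have -> : (fun y : R => (k ^_ n)%:R * y ^+ (k - n)) = horner p.
  by apply/funext => y; rewrite hornerZ hornerXn.
rewrite ffactnSr natrM subnS (_ : _ * _ = p^`().[t]).
  exact: is_derive_poly.
rewrite derivZ derivXn hornerZ hornerMn hornerXn -mulrA; congr (_ * _).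
by rewrite mulr_natl.
Qed.

Lemma vnorm_sqr x : vnorm x ^+ 2 = rho x.
Proof. by rewrite sqr_sqrtr// sumr_ge0// => j _; exact: sqr_ge0. Qed.

Let pow4 j : 2 ^+ (2 * j) = 4 ^+ j :> R.
Proof. by rewrite exprM -natrX. Qed.

(** The series stops because derivatives of t^k of order above k vanish; Gamma(m/2 + j) = (m/2)_j
    Gamma(m/2) cancels the prefactor. *)
Lemma H0E k x : H0 k x = (axial_poly (hgck_coef (m%:R / 2) k) k (x0of x) (rho x))%:A.
Proof.
have m0 : 0 < m%:R / 2 :> R by rewrite divr_gt0// ltr0n.
rewrite /H0 /HGCK [X in vpart x * X](_ : _ = 0); last first.
  rewrite (cvg_lim _ (@cvg_series_finite _ _ _ 0%N _)) ?big_ord0// => j _.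
  have -> : derive1n (2 * j) (fun=> 0 : C) = (fun=> 0).
    elim: (2 * j)%N => // n IH; rewrite derive1nS IH; apply/funext => t.
    by rewrite derive1E; exact: derive_val.
  by rewrite scaler0.
rewrite mulr0 scaler0 addr0.
rewrite (cvg_lim _ (@cvg_series_finite _ _ _ k./2.+1 _)) => [||j kj]//; last first.
  rewrite derive1n_exp ffact_small ?mul0r ?scale0r ?scaler0//.
  by rewrite mul2n -ltn_half_double.
rewrite scaler_sumr /axial_poly scaler_suml; apply: eq_bigr => j _.
rewrite derive1n_exp !scalerA; congr (_ *: _).
rewrite GammaDn// /hgck_coef pow4 -vnorm_sqr exprM.
have g0 := Gamma_gt0 m0.
have f0 : j`!%:R != 0 :> R by rewrite pnatr_eq0 -lt0n fact_gt0.
have r0 := rising_gt0 j m0.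
by field; rewrite f0 !gt_eqF// exprn_gt0.
Qed.

(** Here Gamma(m/2 + j + 1) = (m/2 + 1)_j (m/2) Gamma(m/2) absorbs both prefactors Gamma(m/2) and
    m/2. *)
Lemma H1E k x : H1 k x =
  axial_poly (hgck_coef (m%:R / 2 + 1) k) k (x0of x) (rho x) *: vpart x.
Proof.
have m0 : 0 < m%:R / 2 :> R by rewrite divr_gt0// ltr0n.
have m1 : 0 < m%:R / 2 + 1 :> R by rewrite addr_gt0.
rewrite /H1 /HGCK [X in (X + _)](_ : _ = 0); last first.
  rewrite (cvg_lim _ (@cvg_series_finite _ _ _ 0%N _)) ?big_ord0// => j _.
  have -> : derive1n (2 * j) (fun=> 0 : C) = (fun=> 0).
    elim: (2 * j)%N => // n IH; rewrite derive1nS IH; apply/funext => t.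
    by rewrite derive1E; exact: derive_val.
  by rewrite scaler0.
rewrite add0r (cvg_lim _ (@cvg_series_finite _ _ _ k./2.+1 _)) => [||j kj]//; last first.
  rewrite derive1n_exp ffact_small ?mul0r ?scale0r ?scaler0//.
  by rewrite mul2n -ltn_half_double.
rewrite [RHS]scaler_suml mulr_sumr !scaler_sumr; apply: eq_bigr => j _.
rewrite derive1n_exp -!scalerAr mulr1 !scalerA; congr (_ *: _).
rewrite addrAC GammaDn// GammaD1// /hgck_coef pow4 -vnorm_sqr exprM.
have g0 := Gamma_gt0 m0.
have f0 : j`!%:R != 0 :> R by rewrite pnatr_eq0 -lt0n fact_gt0.
have r0 := rising_gt0 j m1.
by field; rewrite f0 !gt_eqF// ?exprn_gt0// ltr0n.
Qed.

End ExplicitForm.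

(** * Polynomial functions *)

Section ScalarPolynomial.
Variables (R : realType) (n : nat).
Implicit Types f g : 'rV[R]_n -> R.

Definition monomial (e : 'I_n -> nat) (h : 'rV[R]_n) : R := \prod_i h 0 i ^+ e i.

(** An unordered list of monomials with repetitions allowed: sums are concatenations and products
    are lists of pairwise products. Sorting by degree, as in [polynomial_fun], is left to the
    end. *)
Definition scalar_polynomial f :=
  exists s : seq (('I_n -> nat) * R), forall h, f h = \sum_(t <- s) t.2 * monomial t.1 h.

Lemma scalar_polynomial_cst a : scalar_polynomial (fun=> a).
Proof.
exists [:: (fun=> 0%N, a)] => h; rewrite big_seq1/= /monomial big1 ?mulr1//.
Qed.

Lemma scalar_polynomial_coord i : scalar_polynomial (fun h => h 0 i).
Proof.
exists [:: (fun j => (j == i) : nat, 1)] => h.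
rewrite big_seq1 /monomial/= mul1r (bigD1 i)//= eqxx expr1 big1 ?mulr1// => j ji.
by rewrite (negbTE ji).
Qed.

Lemma scalar_polynomialD f g :
  scalar_polynomial f -> scalar_polynomial g -> scalar_polynomial (fun h => f h + g h).
Proof. by move=> [s fs] [t gt]; exists (s ++ t) => h; rewrite big_cat fs gt. Qed.

Lemma scalar_polynomialM f g :
  scalar_polynomial f -> scalar_polynomial g -> scalar_polynomial (fun h => f h * g h).
Proof.
move=> [s fs] [t gt].
exists [seq (fun i => (p.1 i + q.1 i)%N, p.2 * q.2) | p <- s, q <- t] => h.
rewrite big_allpairs_dep fs gt mulr_suml; apply: eq_bigr => p _.
rewrite mulr_sumr; apply: eq_bigr => q _ /=.
rewrite mulrACA; congr (_ * _); rewrite /monomial -big_split; apply: eq_bigr => i _.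
by rewrite exprD.
Qed.

Lemma scalar_polynomialX f k : scalar_polynomial f -> scalar_polynomial (fun h => f h ^+ k).
Proof.
move=> fp; elim: k => [|k IH]; first exact: scalar_polynomial_cst.
by under eq_fun do rewrite exprS; exact: scalar_polynomialM.
Qed.

Lemma scalar_polynomial_sum (I : Type) (r : seq I) (F : I -> 'rV[R]_n -> R) :
  (forall i, scalar_polynomial (F i)) -> scalar_polynomial (fun h => \sum_(i <- r) F i h).
Proof.
move=> Fp; elim: r => [|i r IH].
  by under eq_fun do rewrite big_nil; exact: scalar_polynomial_cst.
by under eq_fun do rewrite big_cons; exact: scalar_polynomialD.
Qed.

Lemma scalar_polynomial_prod (I : Type) (r : seq I) (F : I -> 'rV[R]_n -> R) :
  (forall i, scalar_polynomial (F i)) -> scalar_polynomial (fun h => \prod_(i <- r) F i h).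
Proof.
move=> Fp; elim: r => [|i r IH].
  by under eq_fun do rewrite big_nil; exact: scalar_polynomial_cst.
by under eq_fun do rewrite big_cons; exact: scalar_polynomialM.
Qed.

Lemma scalar_polynomial_shift p f : scalar_polynomial f -> scalar_polynomial (fun h => f (p + h)).
Proof.
move=> [s fs]; under eq_fun do rewrite fs.
apply: scalar_polynomial_sum => t; apply: scalar_polynomialM; first exact: scalar_polynomial_cst.
apply: scalar_polynomial_prod => i; apply: scalar_polynomialX; under eq_fun do rewrite mxE.
by apply: scalar_polynomialD; [exact: scalar_polynomial_cst|exact: scalar_polynomial_coord].
Qed.

End ScalarPolynomial.

Section PolynomialFunctions.
Variables (R : realType) (n : nat) (V : normedModType R).
Implicit Types f g : 'rV[R]_n -> V.

Lemma homogD (c d : forall k, {ffun 'I_n -> 'I_k.+1} -> V) h k :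
  homog (fun k s => c k s + d k s) h k = homog c h k + homog d h k.
Proof. by rewrite -big_split; apply: eq_bigr => s _; rewrite scalerDr. Qed.

(** The expansion can be summed up to any larger degree, so that two polynomials can be written with
    a common bound. *)
Lemma polynomial_funP f : polynomial_fun f <->
  exists (d : nat) (c : forall k, {ffun 'I_n -> 'I_k.+1} -> V),
    (forall k s, (d <= k)%N -> c k s = 0) /\
    forall x N, (d <= N)%N -> f x = \sum_(k < N) homog c x k.
Proof.
split=> [[d [c fc]]|[d [c [_ fc]]]]; last by exists d, c => x; exact: fc.
exists d, (fun k s => if (k < d)%N then c k s else 0); split=> [k s|x N dN].
  by rewrite leqNgt => /negbTE->.
rewrite fc (big_ord_widen _ _ dN) big_mkcond; apply: eq_bigr => k _.
rewrite /homog; case: (k < d)%N => //; rewrite big1// => s _.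
by rewrite scaler0.
Qed.

Lemma polynomial_funD f g :
  polynomial_fun f -> polynomial_fun g -> polynomial_fun (fun x => f x + g x).
Proof.
move=> /polynomial_funP[d [c [_ fc]]] /polynomial_funP[d' [c' [_ gc]]].
exists (maxn d d'), (fun k s => c k s + c' k s) => x.
under eq_bigr do rewrite homogD.
by rewrite big_split -fc ?leq_maxl// -gc// leq_maxr.
Qed.

Lemma polynomial_fun_monomial (e : 'I_n -> nat) (v : V) :
  polynomial_fun (fun x => monomial e x *: v).
Proof.
pose N := (\sum_i e i)%N.
exists N.+1, (fun k (s : {ffun 'I_n -> 'I_k.+1}) =>
  if [forall i, s i == e i :> nat] then v else 0) => x.
have eN i : (e i < N.+1)%N by rewrite ltnS /N (bigD1 i)//= leq_addr.
rewrite big_ord_recr/= big1 ?add0r => [|k _]; last first.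
  rewrite /homog big1// => s /eqP sk; case: ifP => [/forallP se|]; rewrite ?scaler0//.
  have kN : k = N :> nat.
    by rewrite -sk; apply: eq_bigr => i _; exact/eqP.
  by have := leq_ltn_trans (eq_leq (esym kN)) (ltn_ord k); rewrite ltnn.
pose s0 : {ffun 'I_n -> 'I_N.+1} := [ffun i => Ordinal (eN i)].
rewrite /homog (bigD1 s0)/=; last by apply/eqP/eq_bigr => i _; rewrite ffunE.
rewrite ifT; last by apply/forallP => i; rewrite ffunE.
rewrite big1 ?addr0.
  by congr (_ *: _); apply: eq_bigr => i _; rewrite ffunE.
move=> s /andP[_ /eqP ss0]; case: ifP => [/forallP se|]; rewrite ?scaler0//.
by case: ss0; apply/ffunP => i; rewrite ffunE; apply: val_inj; exact: eqP (se i).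
Qed.

Lemma polynomial_fun_scale (f : 'rV[R]_n -> R) (v : V) :
  scalar_polynomial f -> polynomial_fun (fun x => f x *: v).
Proof.
move=> [s fs]; under eq_fun do rewrite fs scaler_suml; elim: s {f fs} => [|t s IH].
  by exists 0%N, (fun _ _ => 0) => x; rewrite big_nil big_ord0.
under eq_fun do rewrite big_cons; apply: polynomial_funD => //.
under eq_fun do rewrite mulrC -scalerA; exact: polynomial_fun_monomial.
Qed.

Lemma polynomial_fun_sum (I : Type) (r : seq I) (F : I -> 'rV[R]_n -> V) :
  (forall i, polynomial_fun (F i)) ->
  polynomial_fun (fun h => \sum_(i <- r) F i h).
Proof.
move=> Fp; elim: r => [|i r IH].
  exists 0%N, (fun _ _ => 0) => x; by rewrite big_nil big_ord0.
by under eq_fun do rewrite big_cons; exact: polynomial_funD.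
Qed.

Lemma polynomial_fun_shift p f :
  polynomial_fun f -> polynomial_fun (fun h => f (p + h)).
Proof.
move=> [d [c fc]]; under eq_fun do rewrite fc.
apply: polynomial_fun_sum => k; rewrite /homog.
under eq_fun do rewrite big_mkcond/=.
apply: polynomial_fun_sum => s; case: (mdeg s == k).
  apply: polynomial_fun_scale; apply: (@scalar_polynomial_shift _ _ p (fun h => monom h s)).
  apply: scalar_polynomial_prod => i; apply: scalar_polynomialX; exact: scalar_polynomial_coord.
by exists 0%N, (fun _ _ => 0) => x; rewrite big_ord0.
Qed.

(** About any point a polynomial re-expands into finitely many homogeneous terms, so every radius
    works; 1 is taken. *)
Lemma polynomial_fun_analytic f : polynomial_fun f -> analytic_on setT f.
Proof.
move=> fp p _; have /polynomial_funP[d [c [c0 fc]]] := polynomial_fun_shift p fp.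
exists c, 1; split => // [|h _].
  apply: cvgP; apply: (@cvg_series_finite _ _ _ d) => k dk.
  by apply: big1 => s _; rewrite c0// normr0 mul0r.
rewrite (fc _ d)//; apply: cvg_series_finite => k dk.
by rewrite /homog big1// => s _; rewrite c0// scaler0.
Qed.

End PolynomialFunctions.

(** * Termwise differentiation of series of polynomials *)

Section PolynomialMajorant.
Variable R : realType.
Implicit Types (p q : {poly R}) (t h e d : R).

(** It bounds the polynomial on [-d, d] and controls derivatives on smaller intervals, in the role
    of Cauchy estimates. *)
Definition majorant p d : R := \sum_(i < size p) `|p`_i| * d ^+ i.

Lemma majorantE p N d : (size p <= N)%N ->
  majorant p d = \sum_(i < N) `|p`_i| * d ^+ i.
Proof.
move=> pN; rewrite /majorant (big_ord_widen _ (fun i => `|p`_i| * d ^+ i) pN) big_mkcond/=.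
apply: eq_bigr => i _; case: ltnP => // /leq_sizeP/(_ _ (leqnn _)) ->.
by rewrite normr0 mul0r.
Qed.

Lemma majorant_ge0 p d : 0 <= d -> 0 <= majorant p d.
Proof. by move=> d0; apply: sumr_ge0 => i _; rewrite mulr_ge0 ?exprn_ge0. Qed.

Lemma majorantD p q d : 0 <= d -> majorant (p + q) d <= majorant p d + majorant q d.
Proof.
move=> d0; pose N := maxn (size p) (size q).
rewrite (majorantE _ (size_polyD p q)) (@majorantE p N) ?leq_maxl//.
rewrite (@majorantE q N) ?leq_maxr// -big_split; apply: ler_sum => i _ /=.
by rewrite coefD -mulrDl ler_wpM2r ?exprn_ge0// ler_normD.
Qed.

Lemma majorantZXn c n d : majorant (c *: 'X^n) d = `|c| * d ^+ n.
Proof.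
rewrite (@majorantE _ n.+1) => [|]; last first.
  by apply: leq_trans (size_scale_leq _ _) _; rewrite size_polyXn.
rewrite big_ord_recr/= big1 => [|i _].
  by rewrite add0r coefZ coefXn eqxx mulr1.
by rewrite coefZ coefXn ltn_eqF ?ltn_ord//= mulr0 normr0 mul0r.
Qed.

Lemma majorant_sum (I : Type) (r : seq I) (c : I -> R) (n : I -> nat) d : 0 <= d ->
  majorant (\sum_(i <- r) c i *: 'X^(n i)) d <= \sum_(i <- r) `|c i| * d ^+ n i.
Proof.
move=> d0; elim: r => [|i r IH].
  by rewrite !big_nil /majorant size_poly0 big_ord0.
rewrite !big_cons; apply: le_trans (majorantD _ _ d0) _.
by rewrite majorantZXn lerD2l.
Qed.

Lemma horner_deriv_coef p t :
  p^`().[t] = \sum_(i < size p) p`_i * (i%:R * t ^+ i.-1).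
Proof.
rewrite -{1}(coefK p) poly_def raddf_sum horner_sum; apply: eq_bigr => i _ /=.
by rewrite derivZ derivXn hornerZ hornerMn hornerXn mulr_natl.
Qed.

Lemma norm_horner_le p t d : `|t| <= d -> `|p.[t]| <= majorant p d.
Proof.
move=> td; rewrite horner_coef; apply: le_trans (ler_norm_sum _ _ _) _.
apply: ler_sum => i _; rewrite normrM normrX ler_wpM2l// lerXn2r ?nnegrE//.
exact: le_trans td.
Qed.

(* Both sides satisfy the same recursion in n, E (n+1) = (t+h) E n + n h^2 t^(n-1). *)
Lemma expr_taylor1_le t h e n : 0 < e -> `|h| <= e ->
  `|(t + h) ^+ n - t ^+ n - h * (n%:R * t ^+ n.-1)| <=
  (h / e) ^+ 2 * ((`|t| + e) ^+ n - `|t| ^+ n - e * (n%:R * `|t| ^+ n.-1)).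
Proof.
move=> e0 he; have rec (u v : R) k :
    (u + v) ^+ k.+1 - u ^+ k.+1 - v * (k.+1%:R * u ^+ k) =
    (u + v) * ((u + v) ^+ k - u ^+ k - v * (k%:R * u ^+ k.-1)) +
    k%:R * v ^+ 2 * u ^+ k.-1.
  case: k => [|k]; first by rewrite !expr0 !expr1; ring.
  by rewrite -(natr1 k.+1) /= !exprS; ring.
elim: n => [|n IH]; first by rewrite !expr0 !subrr !mul0r !mulr0 subrr normr0 mulr0.
rewrite [_.+1.-1]/= !rec [leRHS]mulrDr; apply: le_trans (ler_normD _ _) _.
apply: lerD.
  rewrite normrM [leRHS]mulrCA ler_pM//.
  by apply: le_trans (ler_normD _ _) _; rewrite lerD2l.
rewrite 2!normrM !normrX normr_nat expr_div_n real_normK ?num_real//.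
by rewrite [leRHS](_ : _ = n%:R * h ^+ 2 * `|t| ^+ n.-1)//; field; rewrite gt_eqF.
Qed.

(** The monomial estimate is applied to each coefficient and its nonpositive terms are dropped. The
    bound is quadratic in [h] with a factor that can be summed over a series of polynomials. *)
Lemma horner_taylor1_le p t h e : 0 < e -> `|h| <= e ->
  `|p.[t + h] - p.[t] - h * p^`().[t]| <= (h / e) ^+ 2 * majorant p (`|t| + e).
Proof.
move=> e0 he; rewrite horner_deriv_coef !horner_coef mulr_sumr -!sumrB.
apply: le_trans (ler_norm_sum _ _ _) _; rewrite /majorant mulr_sumr.
apply: ler_sum => i _.
rewrite [X in X - _](_ : _ = p`_i * ((t + h) ^+ i - t ^+ i)); last by ring.
rewrite mulrCA -mulrBr normrM [leRHS]mulrCA ler_wpM2l//.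
apply: le_trans (expr_taylor1_le _ _ e0 he) _; rewrite ler_wpM2l ?sqr_ge0//.
rewrite -addrA gerDl -opprD oppr_le0 addr_ge0 ?exprn_ge0// mulr_ge0 ?(ltW e0)//.
Qed.

(** The estimate of [expr_taylor1_le] at h = e shows that its right-hand side is nonnegative, whence
    e n d^(n-1) <= (d + e)^n. *)
Lemma majorant_deriv_le p d e : 0 <= d -> 0 < e ->
  e * majorant p^`() d <= majorant p (d + e).
Proof.
move=> d0 e0; rewrite (@majorantE _ (size p).-1); last exact: size_poly.
rewrite /majorant; case: (size p) => [|N]; first by rewrite !big_ord0 mulr0.
rewrite big_ord_recl/= mulr_sumr -[leLHS]add0r; apply: lerD.
  by rewrite expr0 mulr1.
apply: ler_sum => i _; rewrite coef_deriv normrMn -mulr_natr -mulrA mulrCA.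
rewrite /bump/= add1n ler_wpM2l//.
have ee : `|e| <= e by rewrite gtr0_norm.
have := expr_taylor1_le d i.+1 e0 ee.
rewrite (@ger0_norm _ d)// => /(le_trans (normr_ge0 _)).
rewrite pmulr_rge0; last by rewrite exprn_gt0// divr_gt0.
rewrite -addrA -opprD subr_ge0; apply: le_trans.
by rewrite lerDr exprn_ge0.
Qed.

End PolynomialMajorant.

Section PolynomialSeries.
Variables (R : realType) (P : nat -> {poly R}) (d : R).
Hypothesis d0 : 0 < d.
Hypothesis Pd : cvgn (series (fun k => majorant (P k) d)).

Definition poly_series (Q : nat -> {poly R}) (t : R) : R := limn (series (fun k => (Q k).[t])).

Lemma cvg_poly_series t : `|t| <= d -> cvgn (series (fun k => (P k).[t])).
Proof.
move=> td; apply: normed_cvg; apply: series_le_cvg Pd => //= [k|k].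
  by apply: majorant_ge0; exact: ltW.
exact: norm_horner_le.
Qed.

Lemma cvg_majorant_deriv e : 0 <= e -> e < d ->
  cvgn (series (fun k => majorant (P k)^`() e)).
Proof.
move=> e0 ed; have de : 0 < d - e by rewrite subr_gt0.
have := is_cvg_seriesZ (k := (d - e)^-1) Pd; apply: series_le_cvg => k /=.
- exact: majorant_ge0.
- rewrite -[leRHS]/((d - e)^-1 * majorant (P k) d).
  by rewrite mulr_ge0 ?majorant_ge0 ?invr_ge0 ?ltW.
- rewrite -[leRHS]/((d - e)^-1 * majorant (P k) d) mulrC ler_pdivlMr//.
  by have := majorant_deriv_le (P k) e0 de; rewrite subrKC mulrC.
Qed.

(** With e = d - |t|, the Taylor remainders sum to at most (h/e)^2 M, where M is the sum of the
    majorants at d. The error of the difference quotient is thus linear in h. *)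
Lemma is_derive_poly_series (t : R) : `|t| < d ->
  is_derive t 1 (poly_series P) (poly_series (fun k => (P k)^`()) t).
Proof.
move=> td; pose e := d - `|t|; have e0 : 0 < e by rewrite subr_gt0.
pose M := limn (series (fun k => majorant (P k) d)).
have cP' : cvgn (series (fun k => (P k)^`().[t])).
  pose d' := (`|t| + d) / 2.
  have td' : `|t| <= d' by rewrite /d'; lra.
  have d'd : d' < d by rewrite /d'; lra.
  have d'0 : 0 <= d' := le_trans (normr_ge0 t) td'.
  apply: normed_cvg; apply: series_le_cvg (cvg_majorant_deriv d'0 d'd) => //= [k|k].
    exact: majorant_ge0.
  exact: norm_horner_le.
have rem h : `|h| <= e ->
    `|poly_series P (t + h) - poly_series P t -
      h * poly_series (fun k => (P k)^`()) t| <= (h / e) ^+ 2 * M.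
  move=> he; have c1 : cvgn (series (fun k => (P k).[t + h])).
    by apply: cvg_poly_series; apply: le_trans (ler_normD _ _) _; rewrite -lerBrDl.
  have c2 : cvgn (series (fun k => (P k).[t])) by apply: cvg_poly_series; exact: ltW.
  have eZ : h * limn (series (fun k => (P k)^`().[t])) =
      limn (series (h *: (fun k => (P k)^`().[t]))) by rewrite lim_seriesZ.
  rewrite /poly_series -lim_seriesB// eZ -lim_seriesB//; last 2 first.
  - exact: is_cvg_seriesB.
  - exact: is_cvg_seriesZ.
  have cM : cvgn (series ((h / e) ^+ 2 *: (fun k => majorant (P k) d))).
    exact: is_cvg_seriesZ.
  have le_rem k : `|(P k).[t + h] - (P k).[t] - h * (P k)^`().[t]|
      <= (h / e) ^+ 2 * majorant (P k) d.
    apply: le_trans (horner_taylor1_le _ _ e0 he) _.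
    by rewrite /e subrKC.
  have cn : cvgn [normed series ((fun k => (P k).[t + h]) - (fun k => (P k).[t])
        - h *: (fun k => (P k)^`().[t]))].
    apply: series_le_cvg cM => k //=; last exact: le_rem.
    by apply: mulr_ge0; rewrite ?sqr_ge0// majorant_ge0// ltW.
  apply: le_trans (lim_series_norm cn) _; rewrite /M -[leRHS]lim_seriesZ//.
  exact: lim_series_le.
have D : (fun h => h^-1 *: ((poly_series P \o shift t) (h *: 1) - poly_series P t)) @ 0^' -->
    poly_series (fun k => (P k)^`()) t.
  pose S := poly_series (fun k => (P k)^`()) t.
  suff : (fun h => h^-1 * (poly_series P (t + h) - poly_series P t - h * S)) @ 0^' --> (0 : R).
    move=> /cvgD /(_ (cvg_cst S)); rewrite add0r; apply: cvg_trans.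
    apply: near_eq_cvg; near=> h; have h0 : h != 0 by near: h; exact: nbhs_dnbhs_neq.
    by rewrite /= !fctE/= /GRing.scale/= mulr1 (addrC t); field.
  apply: (@cvg_to_0_linear _ _ (M / e ^+ 2) e) => // h /andP[h0 he].
  rewrite normrM normfV mulrC ler_pdivrMr//.
  apply: le_trans (rem h (ltW he)) _.
  rewrite expr_div_n -[h ^+ 2]real_normK ?num_real// le_eqVlt; apply/orP; left.
  by apply/eqP; field; rewrite gt_eqF.
by apply: DeriveDef; [exact: cvgP D|exact: cvg_lim D].
Unshelve. all: by end_near. Qed.

End PolynomialSeries.

(** * The Laplacian of an axial function *)

Section PointwiseDerivatives.
Variables (R : realType) (V : normedModType R).
Implicit Types (f g : V -> R) (x v : V).

Lemma is_derive_fD f g x v (df dg : R) : is_derive x v f df ->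
  is_derive x v g dg -> is_derive x v (fun y => f y + g y) (df + dg).
Proof. exact: is_deriveD. Qed.

Lemma is_derive_fcst (a : R) x v : is_derive x v (fun=> a) (0 : R).
Proof. exact: is_derive_cst. Qed.

Lemma is_derive_fM f g x v (df dg : R) : is_derive x v f df ->
  is_derive x v g dg -> is_derive x v (fun y => f y * g y) (f x * dg + g x * df).
Proof. exact: is_deriveM. Qed.

Lemma is_derive_fsum n (f : 'I_n -> V -> R) x v (df : 'I_n -> R) :
  (forall i, is_derive x v (f i) (df i)) ->
  is_derive x v (fun y => \sum_(i < n) f i y) (\sum_(i < n) df i).
Proof.
move=> dfP; have := is_derive_sum dfP.
by rewrite (_ : \sum_(i < n) f i = fun y => \sum_(i < n) f i y)// fct_sumE.
Qed.

End PointwiseDerivatives.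

Section DirectionalDerivatives.
Variables (R : realType) (m : nat).
Local Notation pt := 'rV[R]_m.+1.
Implicit Types (x y v : pt) (F : pt -> R).

(** Along a coordinate line, x0 or [rho] is a polynomial in the parameter and the other one is
    constant. Partial derivatives of s(x0, rho) therefore reduce to a one-variable chain rule,
    without joint differentiability of s. *)
Lemma is_derive_line F x v (phi : R -> R) (g : {poly R}) (D : R) :
  (forall t : R, F (t *: v + x) = phi g.[t]) -> is_derive g.[0] 1 phi D ->
  is_derive x v F (g^`().[0] * D).
Proof.
move=> Fphi dphi; have dg := is_derive_poly g 0.
have [dphig <-] : is_derive (0 : R) 1 (phi \o horner g) (g^`().[0] * D).
  by rewrite mulrC; exact: is_derive1_comp.
have E : (fun h => h^-1 *: ((F \o shift x) (h *: v) - F x)) =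
  (fun h => h^-1 *: (((phi \o horner g) \o shift 0) (h *: 1) - (phi \o horner g) 0)).
  have Fx : F x = phi g.[0] by rewrite -{1}(add0r x) -(scale0r v) Fphi.
  by apply/funext => h /=; rewrite Fphi Fx addr0 [_ *: 1]mulr1.
by apply: DeriveDef; rewrite /derivable /derive E.
Qed.

Definition dir0 : pt := delta_mx 0 ord0.
Definition dirv (j : 'I_m) : pt := delta_mx 0 (lift ord0 j).

Lemma is_derive_coord (i : 'I_m.+1) x v :
  is_derive x v (fun y : pt => y 0 i) (v 0 i).
Proof.
pose p : {poly R} := (v 0 i) *: 'X + (x 0 i)%:P.
have -> : v 0 i = p^`().[0] * 1 by rewrite mulr1 /p !poly.derivE !hornerE.
apply: (@is_derive_line _ _ _ id p).
by move=> t; rewrite !mxE /p !hornerE mulrC.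
Qed.

Lemma is_derive_dir0 (s : R -> R -> R) x (su : R) :
  is_derive (x0of x) 1 (fun u => s u (rho x)) su ->
  is_derive x dir0 (fun y => s (x0of y) (rho y)) su.
Proof.
pose p : {poly R} := 'X + (x0of x)%:P.
have {1}-> : x0of x = p.[0] by rewrite /p !hornerE.
have {2}-> : su = p^`().[0] * su by rewrite /p !poly.derivE !hornerE.
apply: (@is_derive_line _ _ _ (fun u => s u (rho x)) p).
move=> t; rewrite /p !hornerE; congr (s _ _).
  by rewrite /x0of !mxE !eqxx mulr1.
by apply: eq_bigr => j _; rewrite !mxE mulr0 add0r.
Qed.

Lemma rho_dirv (t : R) (j : 'I_m) x :
  rho (t *: dirv j + x) = t ^+ 2 + 2 * x 0 (lift ord0 j) * t + rho x.
Proof.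
rewrite /rho (bigD1 j)//= [in RHS](bigD1 j)//= !mxE !eqxx mulr1 addrA.
congr (_ + _); first by ring.
apply: eq_bigr => i ij; rewrite !mxE (inj_eq lift_inj) (negbTE ij).
by rewrite mulr0 add0r.
Qed.

Lemma is_derive_dirv (s : R -> R -> R) j x (sw : R) :
  is_derive (rho x) 1 (s (x0of x)) sw ->
  is_derive x (dirv j) (fun y => s (x0of y) (rho y))
    (2 * x 0 (lift ord0 j) * sw).
Proof.
pose p : {poly R} := 'X^2 + (2 * x 0 (lift ord0 j)) *: 'X + (rho x)%:P.
have {1}-> : rho x = p.[0] by rewrite /p !hornerE expr0n !add0r.
have -> : 2 * x 0 (lift ord0 j) = p^`().[0] by rewrite /p !poly.derivE !hornerE.
apply: (@is_derive_line _ _ _ (s (x0of x)) p).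
move=> t; rewrite /p !hornerE rho_dirv; congr (s _ _).
by rewrite /x0of !mxE mulr0 add0r.
Qed.

Lemma rho_continuous : continuous (@rho R m).
Proof.
apply: continuous_big => [|j _]; first exact: add_continuous.
move=> x; apply: (@continuous_comp _ _ _ (fun y : pt => y 0 (lift ord0 j))
  (fun t : R => t ^+ 2)); first exact: coord_continuous.
exact: exprn_continuous.
Qed.

(* A function s(u, w) with the partial derivatives occurring in the Laplacian of
   [s (x0of x) (rho x)]. *)
Record jet := Jet { jf : R -> R -> R; jfu : R -> R -> R; jfuu : R -> R -> R;
  jfw : R -> R -> R; jfww : R -> R -> R }.

(** Negative [w] are included, although [rho] is nonnegative, so that the derivatives at w = 0 are
    two-sided and the axis x_ = 0 is not exceptional. *)
Definition is_jet (r : R) (s : jet) := forall u w : R, `|u| < r -> `|w| < r ^+ 2 ->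
  [/\ is_derive u 1 (jf s ^~ w) (jfu s u w), is_derive u 1 (jfu s ^~ w) (jfuu s u w),
      is_derive w 1 (jf s u) (jfw s u w) & is_derive w 1 (jfw s u) (jfww s u w)].

(* For kappa = m this is the Laplacian of [s (x0of x) (rho x)]; the Laplacian of
   x_l s(x0of x, rho x) is x_l times the expression for kappa = m + 2. *)
Definition jet_lap (kappa : R) (s : jet) (u w : R) : R :=
  jfuu s u w + 2 * kappa * jfw s u w + 4 * w * jfww s u w.

Section AxialLaplacian.
Variables (r : R) (E : jet) (O : 'I_m -> jet).
Hypotheses (jE : is_jet r E) (jO : forall l, is_jet r (O l)).
Local Notation at_ s y := (s (x0of y) (rho y)).
Local Notation cr x l := (x 0 (lift ord0 l)).

Definition in_region y := `|x0of y| < r /\ rho y < r ^+ 2.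

Lemma near_region x : in_region x -> \forall y \near x, in_region y.
Proof.
move=> [x0r rhor]; apply: filterI.
  exact: (cvgr_norm_lt (x0of x) (@coord_continuous _ _ _ _ _ x)).
exact: (cvgr_lt (rho x) (@rho_continuous x)).
Qed.

Lemma rho_ge0 x : 0 <= rho x.
Proof. by apply: sumr_ge0 => j _; exact: sqr_ge0. Qed.

(** The shape of one real coordinate of E + x_ O: the coordinate of e_l O depends on l, hence one
    jet for each l. *)
Definition axial y := at_ (jf E) y + \sum_l cr y l * at_ (jf (O l)) y.

Definition axial0 y := at_ (jfu E) y + \sum_l cr y l * at_ (jfu (O l)) y.

Definition axialv j y := 2 * cr y j * at_ (jfw E) y +
  \sum_l (cr y l * (2 * cr y j * at_ (jfw (O l)) y) + at_ (jf (O l)) y * (l == j)%:R).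

Lemma is_derive_axial0 x : in_region x -> is_derive x dir0 axial (axial0 x).
Proof.
move=> [x0r rhor]; have rr : `|rho x| < r ^+ 2 by rewrite ger0_norm ?rho_ge0.
apply: is_derive_fD; first by apply: is_derive_dir0; case: (jE x0r rr).
apply: is_derive_fsum => l.
apply: is_derive_eq.
  apply: is_derive_fM; first exact: is_derive_coord.
  by apply: is_derive_dir0; case: (jO l x0r rr) => h _ _ _; exact: h.
by rewrite /dir0 mxE eq_sym (negbTE (neq_lift _ _)) andbF mulr0 addr0.
Qed.

Lemma is_derive_axial00 x : in_region x -> is_derive x dir0 axial0
  (at_ (jfuu E) x + \sum_l cr x l * at_ (jfuu (O l)) x).
Proof.
move=> [x0r rhor]; have rr : `|rho x| < r ^+ 2 by rewrite ger0_norm ?rho_ge0.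
apply: is_derive_fD; first by apply: is_derive_dir0; case: (jE x0r rr).
apply: is_derive_fsum => l.
apply: is_derive_eq.
  apply: is_derive_fM; first exact: is_derive_coord.
  by apply: is_derive_dir0; case: (jO l x0r rr) => _ h _ _; exact: h.
by rewrite /dir0 mxE eq_sym (negbTE (neq_lift _ _)) andbF mulr0 addr0.
Qed.

Lemma dirv_coord (l j : 'I_m) : cr (dirv j) l = (l == j)%:R.
Proof. by rewrite mxE eqxx (inj_eq lift_inj). Qed.

Lemma is_derive_axialv j x : in_region x -> is_derive x (dirv j) axial (axialv j x).
Proof.
move=> [x0r rhor]; have rr : `|rho x| < r ^+ 2 by rewrite ger0_norm ?rho_ge0.
apply: is_derive_fD; first by apply: is_derive_dirv; case: (jE x0r rr).
apply: is_derive_fsum => l; rewrite -dirv_coord.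
apply: is_derive_fM; first exact: is_derive_coord.
by apply: is_derive_dirv; case: (jO l x0r rr).
Qed.

Lemma is_derive_axialvv j x : in_region x -> is_derive x (dirv j) (axialv j)
  (2 * at_ (jfw E) x + 4 * cr x j ^+ 2 * at_ (jfww E) x +
   \sum_l (2 * cr x l * at_ (jfw (O l)) x + 4 * cr x j ^+ 2 * (cr x l * at_ (jfww (O l)) x)
           + (l == j)%:R * (4 * cr x j * at_ (jfw (O l)) x))).
Proof.
move=> [x0r rhor]; have rr : `|rho x| < r ^+ 2 by rewrite ger0_norm ?rho_ge0.
have d2 : is_derive x (dirv j) (fun y : pt => 2 * cr y j) 2.
  apply: is_derive_eq.
    apply: (is_derive_fM (is_derive_fcst (2 : R) x _)); exact: is_derive_coord.
  by rewrite dirv_coord eqxx mulr1 mulr0 addr0.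
apply: is_derive_fD.
  apply: is_derive_eq.
    apply: (is_derive_fM d2).
    by apply: is_derive_dirv; case: (jE x0r rr) => _ _ _ h; exact: h.
  by rewrite /=; ring.
apply: is_derive_fsum => l.
apply: is_derive_eq.
  apply: is_derive_fD.
    apply: is_derive_fM; first exact: is_derive_coord.
    apply: (is_derive_fM d2).
    by apply: is_derive_dirv; case: (jO l x0r rr) => _ _ _ h; exact: h.
  have dO : is_derive x (dirv j) (fun y => at_ (jf (O l)) y)
      (2 * cr x j * at_ (jfw (O l)) x).
    by apply: is_derive_dirv; case: (jO l x0r rr) => _ _ h _; exact: h.
  exact: (is_derive_fM dO (is_derive_fcst ((l == j)%:R : R) x (dirv j))).
by rewrite dirv_coord; ring.
Qed.

Lemma axial_laplacian F x : in_region x ->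
  (forall y, in_region y -> F y = axial y) ->
  [/\ forall i, \forall y \near x, derivable F y (delta_mx 0 i),
      forall i, derivable ('D_(delta_mx 0 i) F) x (delta_mx 0 i) &
      \sum_(i < m.+1) 'D_(delta_mx 0 i) ('D_(delta_mx 0 i) F) x =
      jet_lap m%:R E (x0of x) (rho x) +
      \sum_l cr x l * jet_lap (m%:R + 2) (O l) (x0of x) (rho x)].
Proof.
move=> xr FE.
have dF i y (g : pt -> R) : in_region y ->
    is_derive y (delta_mx 0 i) axial (g y) -> is_derive y (delta_mx 0 i) F (g y).
  move=> yr; apply: near_eq_is_derive.
  by apply: filterS (near_region yr) => z zr; rewrite FE.
have dF0 y : in_region y -> is_derive y dir0 F (axial0 y).
  by move=> yr; apply: dF => //; exact: is_derive_axial0.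
have dFv j y : in_region y -> is_derive y (dirv j) F (axialv j y).
  by move=> yr; apply: dF => //; exact: is_derive_axialv.
have ddF0 : is_derive x dir0 ('D_dir0 F)
    (at_ (jfuu E) x + \sum_l cr x l * at_ (jfuu (O l)) x).
  apply: near_eq_is_derive (is_derive_axial00 xr).
  by apply: filterS (near_region xr) => z /dF0 [_ ->].
have near_dF j : \forall y \near x, axialv j y = 'D_(dirv j) F y.
  by apply: filterS (near_region xr) => z /(dFv j) [_ ->].
have ddFv j := near_eq_is_derive (near_dF j) (is_derive_axialvv j xr).
have all_dir (Q : pt -> Prop) : Q dir0 -> (forall j, Q (dirv j)) ->
    forall i, Q (delta_mx 0 i).
  by move=> Q0 Qv i; case: (unliftP ord0 i) => [j|] ->; [exact: Qv|exact: Q0].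
split.
- apply: (all_dir (fun v => \forall y \near x, derivable F y v)) => [|j].
    by apply: filterS (near_region xr) => y /dF0 [].
  by apply: filterS (near_region xr) => y /(dFv j) [].
- apply: (all_dir (fun v => derivable ('D_v F) x v)) => [|j]; first by case: ddF0.
  by case: (ddFv j).
rewrite big_ord_recl; have [_ ->] := ddF0.
rewrite (eq_bigr _ (fun j _ => @derive_val _ _ _ _ _ _ _ (ddFv j))).
rewrite big_split/= (exchange_big) /=.
set S := \sum_(l < m) \sum_(j < m) _.
(* The cross terms of the product rule, present only for j = l, contribute 4 x_l s_w; they raise the
   dimension parameter from m to m + 2. *)
have -> : S = \sum_l cr x l * ((2 * m%:R + 4) * at_ (jfw (O l)) x
                             + 4 * rho x * at_ (jfww (O l)) x).
  apply: eq_bigr => l _; rewrite big_split/= big_split/= sumr_const card_ord.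
  rewrite -mulr_suml -mulr_sumr -/(rho x) (bigD1 l)//= eqxx mul1r big1 ?addr0 => [|i].
    by rewrite -mulr_natl; ring.
  by move=> /negbTE il; rewrite eq_sym il mul0r.
rewrite big_split/= sumr_const card_ord -mulr_suml -mulr_sumr -/(rho x).
rewrite -[_ *+ m]mulr_natl addrACA -big_split/= /jet_lap; congr (_ + _); first by ring.
by apply: eq_bigr => l _; ring.
Qed.

End AxialLaplacian.

End DirectionalDerivatives.

(** * Harmonicity of axial polynomials as a recursion on their coefficients *)

Section AxialPolynomialJet.
Variable R : realType.
Implicit Types (a : nat -> R) (k : nat) (u w kappa : R).

Definition polyu a k w : {poly R} := \sum_(j < k./2.+1) (a j * w ^+ j) *: 'X^(k - 2 * j).
Definition polyw a k u : {poly R} := \sum_(j < k./2.+1) (a j * u ^+ (k - 2 * j)) *: 'X^j.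

Lemma horner_polyu a k u w : (polyu a k w).[u] = axial_poly a k u w.
Proof.
rewrite horner_sum; apply: eq_bigr => j _; rewrite hornerZ hornerXn; ring.
Qed.

Lemma horner_polyw a k u w : (polyw a k u).[w] = axial_poly a k u w.
Proof. by rewrite horner_sum; apply: eq_bigr => j _; rewrite hornerZ hornerXn. Qed.

Definition axial_jet a k : jet R :=
  Jet (axial_poly a k) (fun u w => (polyu a k w)^`().[u])
    (fun u w => (polyu a k w)^`()^`().[u]) (fun u w => (polyw a k u)^`().[w])
    (fun u w => (polyw a k u)^`()^`().[w]).

Lemma is_jet_axial_jet r a k : is_jet r (axial_jet a k).
Proof.
move=> u w _ _; split => /=; try exact: is_derive_poly.
  rewrite (_ : (fun u => _) = horner (polyu a k w)); first exact: is_derive_poly.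
  by apply/funext => t; rewrite horner_polyu.
rewrite (_ : axial_poly a k u = horner (polyw a k u)); first exact: is_derive_poly.
by apply/funext => t; rewrite horner_polyw.
Qed.

(** The coefficient of u^(k-2j-2) w^j in the Laplacian: the second u-derivative acts on term j, and
    the w-derivatives act on term j + 1 with factor 2 kappa (j+1) + 4 (j+1) j. *)
Definition lap_coef kappa a k j : R :=
  a j * ((k - 2 * j) * (k - 2 * j).-1)%:R + a j.+1 * (2 * j.+1%:R * (kappa + 2 * j%:R)).

Lemma jet_lap_axial_jet kappa a k u w : jet_lap kappa (axial_jet a k) u w =
  \sum_(j < k./2) lap_coef kappa a k j * u ^+ (k - 2 * j.+1) * w ^+ j.
Proof.
rewrite /jet_lap /=.
have -> : (polyu a k w)^`()^`().[u] = \sum_(j < k./2)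
    a j * ((k - 2 * j) * (k - 2 * j).-1)%:R * u ^+ (k - 2 * j.+1) * w ^+ j.
  rewrite !raddf_sum horner_sum big_ord_recr/= [X in _ + X](_ : _ = 0) ?addr0.
    apply: eq_bigr => j _; rewrite !derivZ derivXn derivMn derivXn hornerZ !hornerMn.
    rewrite hornerXn -mulrnA [in LHS](mulnC (_.-1)) -(mulr_natr (u ^+ _)).
    have -> : (k - 2 * j.+1)%N = (k - 2 * j).-2 by rewrite mulnS addnC subnDA subn2.
    ring.
  rewrite !derivZ derivXn derivMn derivXn hornerZ !hornerMn -mulrnA.
  (* The last term has degree at most 1 in u and disappears in the second derivative. *)
  have -> : (k - 2 * k./2)%N = odd k by rewrite mul2n -{1}(odd_double_half k) addnK.
  by case: (odd k); rewrite ?mulr0n mulr0.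
have w1 : (polyw a k u)^`().[w] = \sum_(j < k./2)
    a j.+1 * u ^+ (k - 2 * j.+1) * (j.+1%:R * w ^+ j).
  rewrite raddf_sum horner_sum big_ord_recl/= derivZ derivXn mulr0n scaler0.
  rewrite horner0 add0r; apply: eq_bigr => j _.
  by rewrite derivZ derivXn hornerZ hornerMn hornerXn mulr_natl.
have w2 : w * (polyw a k u)^`()^`().[w] = \sum_(j < k./2)
    a j.+1 * u ^+ (k - 2 * j.+1) * (j.+1%:R * j%:R * w ^+ j).
  rewrite !raddf_sum horner_sum big_ord_recl/= !derivZ derivXn mulr0n deriv0 scaler0.
  rewrite horner0 add0r mulr_sumr; apply: eq_bigr => j _.
  rewrite !derivZ derivXn derivMn derivXn hornerZ !hornerMn hornerXn /bump/= add1n.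
  rewrite mulrCA; congr (_ * _); rewrite -mulrnA -(mulr_natl (w ^+ _)) natrM.
  case: (j : nat) => [|i]; first by rewrite !mul0r !mulr0 !mul0r.
  by rewrite /= exprS; ring.
rewrite -(mulrA 4) w1 w2 !mulr_sumr -!big_split; apply: eq_bigr => j _ /=.
rewrite /lap_coef; ring.
Qed.

Lemma lap_coef_hgck kappa k j c : 0 < kappa -> (2 * j.+1 <= k)%N ->
  lap_coef kappa (fun i => hgck_coef (kappa / 2) k i * c) k j = 0.
Proof.
move=> k0 jk; rewrite /lap_coef /hgck_coef /= risingS.
have -> : (2 * j.+1)%N = (2 * j).+2 by rewrite mulnS.
rewrite factS 2!ffactnSr -subn1 -subnDA addn1 !natrM !exprS.
have h0 : 0 < kappa / 2 by rewrite divr_gt0.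
have r0 := rising_gt0 j h0.
have f0 : j`!%:R != 0 :> R by rewrite pnatr_eq0 -lt0n fact_gt0.
have e4 : 0 < 4 ^+ j :> R by rewrite exprn_gt0.
have kj : 0 < kappa + 2 * j%:R by rewrite ltr_wpDr// mulr_ge0.
have j1 : 1 + j%:R != 0 :> R by rewrite nat1r pnatr_eq0.
by field; rewrite f0 j1 [_ * 2]mulrC !gt_eqF.
Qed.

Lemma lap_coef_unique kappa a k : 0 < kappa ->
  (forall j, (j < k./2)%N -> lap_coef kappa a k j = 0) ->
  forall j, (j <= k./2)%N -> a j = hgck_coef (kappa / 2) k j * a 0%N.
Proof.
move=> k0 da; elim=> [|j IH] jk.
  by rewrite /hgck_coef muln0 ffactn0 rising0 fact0 !expr0 !mulr1 divr1 mul1r.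
have jk2 : (2 * j.+1 <= k)%N by rewrite mul2n -geq_half_double.
have c0 : 2 * j.+1%:R * (kappa + 2 * j%:R) != 0.
  by rewrite !mulf_neq0 ?pnatr_eq0// gt_eqF// ltr_wpDr// mulr_ge0.
apply: (mulIf c0); have := da j jk; rewrite /lap_coef (IH (ltnW jk)).
have := lap_coef_hgck (a 0%N) k0 jk2; rewrite /lap_coef => <- /addrI; exact.
Qed.

End AxialPolynomialJet.

(** * Convergent series of axial polynomials *)

Section AxialSeries.
Variables (R : realType) (a : nat -> nat -> R) (r : R).
Implicit Types (k : nat) (u w kappa d : R).

(** Since [w] has weight 2, every monomial of degree k is at most r^k for |u| <= r and |w| <= r^2;
    one series thus dominates the expansions in u and in w. *)
Definition axial_majorant k : R := \sum_(j < k./2.+1) `|a k j| * r ^+ k.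

Hypotheses (r0 : 0 < r) (cvg_axial_majorant : cvgn (series axial_majorant)).

Lemma le_half_double k (j : 'I_k./2.+1) : (2 * j <= k)%N.
Proof. by rewrite mul2n -geq_half_double leq_ord. Qed.

Lemma monomial_le k (j : 'I_k./2.+1) (u w : R) :
  `|u| <= r -> `|w| <= r ^+ 2 -> `|w| ^+ j * `|u| ^+ (k - 2 * j) <= r ^+ k.
Proof.
move=> ur wr; have -> : r ^+ k = (r ^+ 2) ^+ j * r ^+ (k - 2 * j).
  by rewrite -exprM -exprD subnKC// le_half_double.
by apply: ler_pM; rewrite ?exprn_ge0//; apply: lerXn2r => //;
  rewrite nnegrE ?exprn_ge0 ?(ltW r0).
Qed.

Lemma majorant_polyu k w : `|w| <= r ^+ 2 -> majorant (polyu (a k) k w) r <= axial_majorant k.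
Proof.
move=> wr; apply: le_trans (majorant_sum _ _ _ (ltW r0)) _.
apply: ler_sum => j _; rewrite normrM normrX -mulrA ler_wpM2l//.
by rewrite -{1}(gtr0_norm r0) monomial_le// gtr0_norm.
Qed.

Lemma majorant_polyw k u : `|u| <= r -> majorant (polyw (a k) k u) (r ^+ 2) <= axial_majorant k.
Proof.
move=> ur; have r2 : 0 < r ^+ 2 by rewrite exprn_gt0.
apply: le_trans (majorant_sum _ _ (fun j => nat_of_ord j) (ltW r2)) _.
apply: ler_sum => j _; rewrite normrM normrX -mulrA ler_wpM2l//.
by rewrite mulrC -{1}(gtr0_norm r2) monomial_le// gtr0_norm.
Qed.

Lemma axial_majorant_ge0 k : 0 <= axial_majorant k.
Proof. by apply: sumr_ge0 => j _; rewrite mulr_ge0 ?exprn_ge0 ?(ltW r0). Qed.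

Lemma cvg_majorant_polyu w : `|w| <= r ^+ 2 ->
  cvgn (series (fun k => majorant (polyu (a k) k w) r)).
Proof.
move=> wr; apply: series_le_cvg cvg_axial_majorant => k; first exact/majorant_ge0/ltW.
  exact: axial_majorant_ge0.
exact: majorant_polyu.
Qed.

Lemma cvg_majorant_polyw u : `|u| <= r ->
  cvgn (series (fun k => majorant (polyw (a k) k u) (r ^+ 2))).
Proof.
move=> wr; apply: series_le_cvg cvg_axial_majorant => k; first exact/majorant_ge0/exprn_ge0/ltW.
  exact: axial_majorant_ge0.
exact: majorant_polyw.
Qed.

Definition series_jet : jet R :=
  Jet (fun u w => limn (series (fun k => axial_poly (a k) k u w)))
    (fun u w => poly_series (fun k => (polyu (a k) k w)^`()) u)
    (fun u w => poly_series (fun k => (polyu (a k) k w)^`()^`()) u)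
    (fun u w => poly_series (fun k => (polyw (a k) k u)^`()) w)
    (fun u w => poly_series (fun k => (polyw (a k) k u)^`()^`()) w).

Lemma is_derive2_poly_series (P : nat -> {poly R}) d (t : R) : 0 < d ->
  cvgn (series (fun k => majorant (P k) d)) -> `|t| < d ->
  [/\ is_derive t 1 (poly_series P) (poly_series (fun k => (P k)^`()) t),
      is_derive t 1 (poly_series (fun k => (P k)^`())) (poly_series (fun k => (P k)^`()^`()) t),
      cvgn (series (fun k => (P k)^`().[t])) &
      cvgn (series (fun k => (P k)^`()^`().[t]))].
Proof.
(* Each differentiation costs some radius of convergence, whence |t| < e' < e < d. *)
move=> d0 Pd td; pose e := (`|t| + d) / 2; pose e' := (`|t| + e) / 2.
have te : `|t| < e by rewrite /e; lra.
have te' : `|t| < e' by rewrite /e'; lra.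
have ed : e < d by rewrite /e; lra.
have e'e : e' < e by rewrite /e'; lra.
have e0 : 0 < e by apply: le_lt_trans te.
have e'0 : 0 < e' by apply: le_lt_trans te'.
have Pe := cvg_majorant_deriv d0 Pd (ltW e0) ed.
have Pe' := cvg_majorant_deriv e0 Pe (ltW e'0) e'e.
have D1 := is_derive_poly_series d0 Pd td; have D2 := is_derive_poly_series e0 Pe te.
have C1 := cvg_poly_series e0 Pe (ltW te); have C2 := cvg_poly_series e'0 Pe' (ltW te').
by split.
Qed.

Lemma is_jet_series_jet : is_jet r series_jet.
Proof.
move=> u w ur wr; have r2 : 0 < r ^+ 2 by rewrite exprn_gt0.
have [d1 d2 _ _] := is_derive2_poly_series r0 (cvg_majorant_polyu (ltW wr)) ur.
have [d3 d4 _ _] := is_derive2_poly_series r2 (cvg_majorant_polyw (ltW ur)) wr.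
have eu : (fun u => jf series_jet u w) = poly_series (fun k => polyu (a k) k w).
  by apply/funext => t; rewrite /poly_series; under eq_fun do rewrite horner_polyu.
have ew : jf series_jet u = poly_series (fun k => polyw (a k) k u).
  by apply/funext => t; rewrite /poly_series; under eq_fun do rewrite horner_polyw.
by rewrite eu ew; apply: And4.
Qed.

Lemma cvg_jet_lap_series_jet kappa u w : `|u| < r -> `|w| < r ^+ 2 ->
  series (fun k => jet_lap kappa (axial_jet (a k) k) u w) @ \oo --> jet_lap kappa series_jet u w.
Proof.
move=> ur wr; have r2 : 0 < r ^+ 2 by rewrite exprn_gt0.
have [_ _ _ c1] := is_derive2_poly_series r0 (cvg_majorant_polyu (ltW wr)) ur.
have [_ _ c2 c3] := is_derive2_poly_series r2 (cvg_majorant_polyw (ltW ur)) wr.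
rewrite (_ : series _ = series (fun k => (polyu (a k) k w)^`()^`().[u])
  + (2 * kappa) *: series (fun k => (polyw (a k) k u)^`().[w])
  + (4 * w) *: series (fun k => (polyw (a k) k u)^`()^`().[w])).
  by apply: cvgD; [apply: cvgD => //|]; exact: cvgZl_tmp.
by rewrite -!seriesZ -!seriesD.
Qed.

End AxialSeries.

(** * Identity theorem for power series and vanishing of each harmonic component *)

Section Uniqueness.
Variable R : realType.

(** Convergence at 1/2 gives |b_k| <= M 2^k, hence absolute convergence at 1/4. The sum is then
    differentiable, so continuous at 0, and b_0 is its limit from the right, where it vanishes. *)
Lemma power_series_unique0 (b : nat -> R) :
  (forall t : R, 0 < t < 1 -> series (fun k => b k * t ^+ k) @ \oo --> (0 : R)) ->
  b 0%N = 0.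
Proof.
move=> b0; have h01 : 0 < (2^-1 : R) < 1 by rewrite invr_gt0 invf_lt1 ?ltr1n ltr0n.
have [M Mb] : exists M, forall k, `|b k| * (2^-1) ^+ k <= M.
  have /cvgP /cvg_series_bounded [M [_ Mb]] := b0 _ h01.
  have MM : M < M + 1 by rewrite ltrDl.
  exists (M + 1) => k; have := Mb _ MM k Logic.I.
  rewrite /= normrM normrX (@gtr0_norm _ 2^-1)//; by case/andP: h01.
pose P k : {poly R} := b k *: 'X^k; pose d : R := 4^-1.
have d0 : 0 < d by rewrite invr_gt0.
have Pd : cvgn (series (fun k => majorant (P k) d)).
  apply: (@series_le_cvg _ _ (fun k => M * 2^-1 ^+ k)) => [k|k|k|].
  - exact/majorant_ge0/ltW.
  - by apply: le_trans (ler_wpM2r _ (Mb k)); rewrite ?mulr_ge0 ?exprn_ge0 ?invr_ge0.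
  - rewrite majorantZXn (_ : d = 2^-1 * 2^-1); last by rewrite /d; field.
    by rewrite exprMn mulrA ler_wpM2r// exprn_ge0// invr_ge0.
  - apply: is_cvg_geometric_series; rewrite gtr0_norm; by case/andP: h01.
have P0 t : 0 < t < 1 -> poly_series P t = 0.
  move=> /b0 bt; apply: cvg_lim => //; move: bt.
  by under eq_fun do rewrite -hornerXn -hornerZ.
have Pb : poly_series P 0 = b 0%N.
  rewrite /poly_series (cvg_lim _ (@cvg_series_finite _ _ _ 1%N _))//.
    by rewrite big_ord1 /P expr0 hornerZ hornerC mulr1.
  by case=> // k _; rewrite /P hornerZ hornerXn expr0n mulr0.
have n0 : `|0 : R| < d by rewrite normr0.
have [dP _] := is_derive_poly_series d0 Pd n0.
have cP : poly_series P @ (0 : R)^'+ --> poly_series P 0.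
  by apply: cvg_at_right_filter; apply/differentiable_continuous/derivable1_diffP.
rewrite -Pb; apply/esym; rewrite -(cvg_lim _ cP)//; apply/esym/cvg_lim => //.
apply: cvg_near_cst; near=> t; apply: P0; apply/andP; split.
  by near: t; exact: nbhs_right_gt.
by near: t; exact: nbhs_right_lt.
Unshelve. all: by end_near. Qed.

Lemma power_series_unique (b : nat -> R) :
  (forall t : R, 0 < t < 1 -> series (fun k => b k * t ^+ k) @ \oo --> (0 : R)) ->
  forall k, b k = 0.
Proof.
move=> bt k; elim: k b bt => [|k IH] b bt; first exact: power_series_unique0.
have b0 := power_series_unique0 bt.
apply: (IH (fun j => b j.+1)) => t t01; have t0 : 0 < t by case/andP: t01.
have := bt t t01; rewrite -cvg_shiftS => /(cvgZl_tmp (k := t^-1)).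
rewrite scaler0; apply: cvg_trans; apply: near_eq_cvg; apply: nearW => n /=.
rewrite /series/= big_nat_recl// b0 mul0r add0r scaler_sumr; apply: eq_bigr => i _.
by rewrite exprS [_ *: _]mulrC; field; rewrite gt_eqF.
Qed.

Lemma jet_lap_series_jet_unique (a : nat -> nat -> R) r kappa : 0 < r ->
  cvgn (series (axial_majorant a r)) ->
  (forall u w, 0 < u < r -> 0 < w < r ^+ 2 -> jet_lap kappa (series_jet a) u w = 0) ->
  forall k j, (j < k./2)%N -> lap_coef kappa (a k) k j = 0.
Proof.
move=> r0 cva lap0 k.
have r2 : 0 < r ^+ 2 by rewrite exprn_gt0.
(* At (t u, t^2 w) the Laplacian of component k, multiplied by t^2, is t^k times its value at (u,
   w); uniqueness of power series in t isolates each component. *)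
have Tk u w : 0 < u < r -> 0 < w < r ^+ 2 -> jet_lap kappa (axial_jet (a k) k) u w = 0.
  move=> /andP[u0 ur] /andP[w0 wr].
  apply: (@power_series_unique (fun k => jet_lap kappa (axial_jet (a k) k) u w)) => t /andP[t0 t1].
  have tu : 0 < t * u < r.
    by rewrite mulr_gt0//= (lt_trans _ ur)// gtr_pMl.
  have tw : 0 < t ^+ 2 * w < r ^+ 2.
    by rewrite mulr_gt0 ?exprn_gt0//= (lt_trans _ wr)// gtr_pMl// exprn_ilt1// ltW.
  have := @cvg_jet_lap_series_jet _ a r r0 cva kappa (t * u) (t ^+ 2 * w).
  rewrite lap0// !gtr0_norm; [|by case/andP: tw|by case/andP: tu].
  move=> /(_ (andP tu).2 (andP tw).2) /(cvgZl_tmp (k := (t ^+ 2))).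
  rewrite scaler0; apply: cvg_trans; apply: near_eq_cvg; apply: nearW => n /=.
  rewrite /series/= scaler_sumr; apply: eq_bigr => i _.
  rewrite !jet_lap_axial_jet scaler_sumr mulr_suml; apply: eq_bigr => j _.
  have ji : (2 * j.+1 <= i)%N by rewrite mul2n -geq_half_double ltn_ord.
  have -> : t ^+ i = t ^+ 2 * (t ^+ 2) ^+ j * t ^+ (i - 2 * j.+1).
    by rewrite -exprM -!exprD -mulnS subnKC.
  rewrite !exprMn -[_ *: _]/(_ * _); ring.
(* A second use of uniqueness, in w = t r^2 at a fixed u = c; as c is nonzero, its powers can be
   cancelled from the coefficients. *)
pose c := r / 2; have c0 : 0 < c by rewrite divr_gt0.
have cr : c < r by rewrite /c; lra.
move=> j jk.
pose b j := if (j < k./2)%N then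
  lap_coef kappa (a k) k j * c ^+ (k - 2 * j.+1) * (r ^+ 2) ^+ j else 0.
suff : b j = 0.
  rewrite /b jk => /eqP; rewrite !mulf_eq0 !expf_eq0 (gt_eqF c0) (gt_eqF r0) !andbF !orbF.
  by move/eqP.
apply: power_series_unique => t /andP[t0 t1].
have -> : 0 = \sum_(i < k./2) b i * t ^+ i :> R.
  transitivity (jet_lap kappa (axial_jet (a k) k) c (t * r ^+ 2)).
    by rewrite Tk// ?c0// mulr_gt0//= gtr_pMl.
  rewrite jet_lap_axial_jet; apply: eq_bigr => i _; rewrite /b ltn_ord (exprMn i t); ring.
by apply: cvg_series_finite => i ki; rewrite /b ltnNge ki mul0r.
Qed.

End Uniqueness.

(** * Real coordinates of Clifford-valued functions *)

Section CliffordCoordinates.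
Variables (R : realType) (m : nat).
Local Notation C := (clifford R m).
Local Notation pt := 'rV[R]_m.+1.
Implicit Types (b c : C) (D : {set 'I_m}) (l : 'I_m) (x y v : pt).

Lemma coef_norm_le c D : `|coef c D| <= `|c|.
Proof.
rewrite [leRHS]/Num.Def.normr/= mx_normrE.
exact: (le_bigmax _ (fun i => `|(c : 'rV_(_)) i.1 i.2|) (0, enum_rank D)).
Qed.

Lemma norm_le_coef c (e : R) : 0 <= e -> (forall D, `|coef c D| <= e) -> `|c| <= e.
Proof.
move=> e0 ce; rewrite [leLHS]/Num.Def.normr/= mx_normrE bigmax_le// => -[i j] _.
by have := ce (enum_val j); rewrite /coef enum_valK ord1.
Qed.

(** Left multiplication by a generator permutes the coordinates up to sign, so each coordinate of
    the product is bounded by the norm of [b]. *)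
Lemma coef_egenM l b D : coef (egen R l * b) D =
  csign R [set l]%SET (symdiff [set l]%SET D) * coef b (symdiff [set l]%SET D).
Proof.
rewrite [coef _ _]Defs.coefK (bigD1 [set l]%SET)//= Defs.coefK eqxx mul1r.
rewrite big1 ?addr0 => [|A Al]; first by rewrite mulrC.
by rewrite Defs.coefK (negbTE Al) !mul0r.
Qed.

Lemma csign_norm (A B : {set 'I_m}) : `|csign R A B : R| = 1 :> R.
Proof.
rewrite /csign normr_prod big1// => i _; rewrite normr_prod big1// => j _.
by case: ifP; rewrite ?normrN normr1.
Qed.

Lemma coef_egenM_le l b D : `|coef (egen R l * b) D| <= `|b|.
Proof. by rewrite coef_egenM normrM csign_norm mul1r coef_norm_le. Qed.

Lemma coef_vpartM x b D :
  coef (vpart x * b) D = \sum_l x 0 (lift ord0 l) * coef (egen R l * b) D.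
Proof.
rewrite /vpart mulr_suml.
rewrite (big_morph (fun c => coef c D) (id1 := 0) (op1 := +%R))/=.
- by apply: eq_bigr => l _; rewrite -scalerAl Defs.coefZ.
- by move=> c d; rewrite Defs.coefD.
- by rewrite /coef mxE.
Qed.

Lemma derivable_coef (f : pt -> C) x v :
  (forall D, derivable (fun y => coef (f y) D) x v) -> derivable f x v.
Proof.
move=> df; apply/(@derivable_mxP R pt 1 _ f) => i j; rewrite ord1.
by have := df (enum_val j); rewrite /coef enum_valK.
Qed.

Lemma coef_derive (f : pt -> C) x v D : derivable f x v ->
  coef ('D_v f x) D = 'D_v (fun y => coef (f y) D) x.
Proof.
move=> /(@derive_mx R pt 1 _ f) fx.
have := congr1 (fun M : 'rV_#|{set 'I_m}| => M 0 (enum_rank D)) fx.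
by rewrite [RHS]mxE.
Qed.

(** For the outer derivative, the inner one must be computed coordinatewise on a whole neighbourhood
    of [x]; finiteness of the set of coordinates gives a common one. *)
Lemma coef_laplacian (f : pt -> C) x :
  (forall D i, \forall y \near x, derivable (fun y => coef (f y) D) y (delta_mx 0 i)) ->
  (forall D i, derivable ('D_(delta_mx 0 i) (fun y => coef (f y) D)) x (delta_mx 0 i)) ->
  forall D, coef (laplacian f x) D =
   \sum_(i < m.+1) 'D_(delta_mx 0 i) ('D_(delta_mx 0 i) (fun y => coef (f y) D)) x.
Proof.
move=> df ddf D; have ndf i : \forall y \near x, forall B,
    derivable (fun y => coef (f y) B) y (delta_mx 0 i).
  exact: (@filter_forall _ _ (fun B y => derivable (fun y => coef (f y) B) y
    (delta_mx 0 i)) (nbhs x) _ (fun B => df B i)).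
have near_eq i B : \forall y \near x, 'D_(delta_mx 0 i) (fun y => coef (f y) B) y =
    coef ('D_(delta_mx 0 i) f y) B.
  by apply: filterS (ndf i) => y dfy; rewrite coef_derive//; exact: derivable_coef.
rewrite /laplacian (big_morph (fun c => coef c D) (id1 := 0) (op1 := +%R))/=.
- apply: eq_bigr => i _; rewrite coef_derive.
    by apply: near_eq_derive; apply: filterS (near_eq i D) => y ->.
  apply: derivable_coef => B; apply: near_eq_derivable (ddf B i).
  exact: near_eq.
- by move=> c d; rewrite Defs.coefD.
- by rewrite /coef mxE.
Qed.

Lemma coef_axial_laplacian r (E : {set 'I_m} -> jet R) (O : {set 'I_m} -> 'I_m -> jet R)
    (f : pt -> C) x :
  (forall D, is_jet r (E D)) -> (forall D l, is_jet r (O D l)) -> in_region r x ->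
  (forall D y, in_region r y -> coef (f y) D = axial (E D) (O D) y) ->
  forall D, coef (laplacian f x) D = jet_lap m%:R (E D) (x0of x) (rho x) +
    \sum_l x 0 (lift ord0 l) * jet_lap (m%:R + 2) (O D l) (x0of x) (rho x).
Proof.
move=> jE jO xr fE D.
rewrite coef_laplacian => [|B i|B i].
- by have [_ _ ->] := axial_laplacian (jE D) (jO D) xr (fE D).
- by have [+ _ _] := axial_laplacian (jE B) (jO B) xr (fE B); exact.
- by have [_ + _] := axial_laplacian (jE B) (jO B) xr (fE B); exact.
Qed.

End CliffordCoordinates.

Lemma scalar_polynomial_axial_poly (R : realType) n c k (f g : 'rV[R]_n -> R) :
  scalar_polynomial f -> scalar_polynomial g ->
    scalar_polynomial (fun x => axial_poly c k (f x) (g x)).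
Proof.
move=> fp gp; apply: scalar_polynomial_sum => j; apply: scalar_polynomialM;
  last exact: scalar_polynomialX.
by apply: scalar_polynomialM; [exact: scalar_polynomial_cst|exact: scalar_polynomialX].
Qed.

(** * The generators are axially harmonic polynomials *)

Section HarmonicPolynomials.
Variables (R : realType) (m : nat).
Hypothesis m_gt0 : (0 < m)%N.
Local Notation C := (clifford R m).
Local Notation pt := 'rV[R]_m.+1.
Implicit Types (x y : pt) (k : nat).

Let m0 : 0 < m%:R :> R. Proof. by rewrite ltr0n. Qed.

Lemma scalar_polynomial_rho : scalar_polynomial (@rho R m).
Proof. by apply: scalar_polynomial_sum => j;
  apply: scalar_polynomialX; exact: scalar_polynomial_coord. Qed.

Lemma scalar_polynomial_axial c k :
  scalar_polynomial (fun x : pt => axial_poly c k (x0of x) (rho x)).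
Proof. by apply: scalar_polynomial_axial_poly; [exact: scalar_polynomial_coord
  |exact: scalar_polynomial_rho]. Qed.

Lemma H0_polynomial k : polynomial_fun (@H0 R m k).
Proof.
by rewrite (funext (H0E m_gt0 k)); apply: polynomial_fun_scale; exact: scalar_polynomial_axial.
Qed.

Lemma H1_polynomial k : polynomial_fun (@H1 R m k).
Proof.
rewrite (funext (H1E m_gt0 k)); under eq_fun do rewrite scaler_sumr.
apply: polynomial_fun_sum => l; under eq_fun do rewrite scalerA.
apply: polynomial_fun_scale; apply: scalar_polynomialM; last exact: scalar_polynomial_coord.
exact: scalar_polynomial_axial.
Qed.

Lemma axial_poly_scale (a : nat -> R) c k u w :
  axial_poly a k u w * c = axial_poly (fun j => a j * c) k u w.
Proof. by rewrite /axial_poly mulr_suml; apply: eq_bigr => j _; ring. Qed.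

Lemma axial_poly0 k u w : axial_poly (fun=> 0 : R) k u w = 0.
Proof. by rewrite /axial_poly big1// => j _; rewrite !mul0r. Qed.

Lemma jet_lap_hgck kappa c k u w : 0 < kappa ->
  jet_lap kappa (axial_jet (fun j => hgck_coef (kappa / 2) k j * c) k) u w = 0 :> R.
Proof.
move=> k0; rewrite jet_lap_axial_jet big1// => j _.
by rewrite lap_coef_hgck ?mul0r// mul2n -geq_half_double ltn_ord.
Qed.

Lemma jet_lap_axial_jet0 kappa k u w : jet_lap kappa (axial_jet (fun=> 0 : R) k) u w = 0.
Proof. by rewrite jet_lap_axial_jet big1// => j _; rewrite /lap_coef !mul0r addr0 !mul0r. Qed.

Lemma region_exists x : exists r : R, in_region r x.
Proof.
exists (1 + `|x0of x| + rho x); have r0 := rho_ge0 x; have a0 := normr_ge0 (x0of x).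
split; first by lra.
by rewrite expr2; nra.
Qed.

Lemma H0_laplacian k x : laplacian (@H0 R m k) x = 0.
Proof.
have [r xr] := region_exists x; apply: clifford_eqP => D.
rewrite (coef_axial_laplacian
  (E := fun D => axial_jet (fun j => hgck_coef (m%:R / 2) k j * coef (1 : C) D) k)
  (O := fun D l => axial_jet (fun=> 0) k) _ _ xr).
- rewrite jet_lap_hgck// add0r big1 => [|l _]; last by rewrite jet_lap_axial_jet0 mulr0.
  by rewrite /coef mxE.
- by move=> ?; exact: is_jet_axial_jet.
- by move=> ? ?; exact: is_jet_axial_jet.
- move=> B y _; rewrite H0E// Defs.coefZ /axial /= axial_poly_scale big1 ?addr0// => l _.
  by rewrite axial_poly0 mulr0.
Qed.

Lemma H1_laplacian k x : laplacian (@H1 R m k) x = 0.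
Proof.
have [r xr] := region_exists x; apply: clifford_eqP => D.
have e2 : (m%:R / 2 + 1 : R) = (m%:R + 2) / 2 by field.
rewrite (coef_axial_laplacian (E := fun D => axial_jet (fun=> 0) k)
  (O := fun D l =>
    axial_jet (fun j => hgck_coef ((m%:R + 2) / 2) k j * coef (egen R l) D) k)
  _ _ xr).
- rewrite jet_lap_axial_jet0 add0r big1 => [|l _]; first by rewrite /coef mxE.
  by rewrite jet_lap_hgck ?mulr0// addr_gt0.
- by move=> ?; exact: is_jet_axial_jet.
- by move=> ? ?; exact: is_jet_axial_jet.
- move=> B y _; rewrite H1E// e2 Defs.coefZ /axial /= axial_poly0 add0r.
  rewrite -[vpart y]mulr1 coef_vpartM mulr_sumr; apply: eq_bigr => l _.
  by rewrite mulr1 -axial_poly_scale; ring.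
Qed.

Lemma H0_axially_harmonic k : axially_harmonic setT (@H0 R m k).
Proof.
split; first by move=> x _; exact: polynomial_fun_analytic (H0_polynomial k) x Logic.I.
- pose h u v : C := (axial_poly (hgck_coef (m%:R / 2) k) k u (v ^+ 2))%:A.
  exists h, (fun _ _ => 0); split => [p _|p _|p _|p _|x _].
  + apply: polynomial_fun_analytic => //; apply: polynomial_fun_scale.
    by apply: scalar_polynomial_axial_poly; [exact: scalar_polynomial_coord
      |apply: scalar_polynomialX; exact: scalar_polynomial_coord].
  + by apply: polynomial_fun_analytic => //; exists 0%N, (fun _ _ => 0) => x; rewrite big_ord0.
  + by rewrite /h sqrrN.
  + by rewrite oppr0.
  + by rewrite mulr0 addr0 /h vnorm_sqr H0E.
- by move=> x _; exact: H0_laplacian.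
Qed.

Lemma vnorm_eq0 x : vnorm x = 0 -> forall l, x 0 (lift ord0 l) = 0.
Proof.
move=> v0 l; apply/eqP; rewrite -sqrf_eq0 -[_ == 0]/(_ == 0).
have : rho x == 0 by rewrite -vnorm_sqr v0 expr0n.
by rewrite psumr_eq0 => [/allP/(_ l (mem_index_enum _))|? _]; rewrite ?sqr_ge0.
Qed.

Lemma vpart_vnorm0 x : vnorm x = 0 -> vpart x = 0.
Proof. by move=> /vnorm_eq0 v0; rewrite /vpart big1// => l _; rewrite v0 scale0r. Qed.

(** Valid on the axis too: when [vnorm x] is 0 its inverse is 0 by convention, and [vpart x]
    vanishes as well. *)
Lemma vnorm_cancel x (c : C) : (vnorm x)^-1 *: vpart x * (vnorm x *: c) = vpart x * c.
Proof.
have [v0|v0] := eqVneq (vnorm x) 0; first by rewrite (vpart_vnorm0 v0) scaler0 !mul0r.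
by rewrite -scalerAl -scalerAr scalerA mulVf// scale1r.
Qed.

Lemma H1_axially_harmonic k : axially_harmonic setT (@H1 R m k).
Proof.
split; first by move=> x _; exact: polynomial_fun_analytic (H1_polynomial k) x Logic.I.
- pose h u v : C := (v * axial_poly (hgck_coef (m%:R / 2 + 1) k) k u (v ^+ 2))%:A.
  exists (fun _ _ => 0), h; split => [p _|p _|p _|p _|x _].
  + by apply: polynomial_fun_analytic => //; exists 0%N, (fun _ _ => 0) => x; rewrite big_ord0.
  + apply: polynomial_fun_analytic => //; apply: polynomial_fun_scale.
    apply: scalar_polynomialM; first exact: scalar_polynomial_coord.
    by apply: scalar_polynomial_axial_poly; [exact: scalar_polynomial_coord
      |apply: scalar_polynomialX; exact: scalar_polynomial_coord].
  + by [].
  + by rewrite /h sqrrN mulNr scaleNr.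
  + by rewrite add0r /h -scalerA vnorm_cancel vnorm_sqr H1E// mulr_algr.
- by move=> x _; exact: H1_laplacian.
Qed.

End HarmonicPolynomials.

(** * Local expansion of an axially harmonic function *)

Section SeriesTail.
Variables (R : realType) (V : normedModType R).
Implicit Types (F : nat -> V) (L : V) (M : nat -> R).

Lemma series_tail_le F L M : series F @ \oo --> L -> (forall k, `|F k| <= M k) ->
  cvgn (series M) -> forall n, `|L - series F n| <= limn (series M) - series M n.
Proof.
move=> FL FM cM n.
have M0 k : 0 <= M k by apply: le_trans (FM k).
have c : `|series F N - series F n| @[N --> \oo] --> `|L - series F n|.
  by apply: cvg_norm; apply: cvgB => //; exact: cvg_cst.
apply: (cvgr_to_le c); near=> N; have nN : (n <= N)%N by near: N; exact: nbhs_infty_ge.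
rewrite sub_series_geq//; apply: le_trans (ler_norm_sum _ _ _) _.
apply: (@le_trans _ _ (series M N - series M n)).
  by rewrite sub_series_geq//; apply: ler_sum => k _.
rewrite lerD2r; apply: nondecreasing_cvgn_le => //.
exact: nondecreasing_series.
Unshelve. all: by end_near. Qed.

Lemma cvg_series_tail M : cvgn (series M) ->
  limn (series M) - series M n @[n --> \oo] --> (0 : R).
Proof. by move=> cM; rewrite -(subrr (limn (series M))); apply: cvgB => //; exact: cvg_cst. Qed.

End SeriesTail.

Lemma uniform_cvgP (T : choiceType) (R : realType) (V : normedModType R) (A : set T)
    (F : nat -> T -> V) (f : T -> V) (e : nat -> R) :
  (forall n x, A x -> `|f x - F n x| <= e n) -> e @ \oo --> (0 : R) ->
  {uniform A, F @ \oo --> f}.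
Proof.
move=> Fe e0 P /uniform_nbhs [E [entE EP]].
have [d d0 dE] : exists2 d : R, 0 < d & forall a b : V, `|a - b| < d -> E (a, b).
  move: entE; rewrite -entourage_ballE => -[d /= d0 dE].
  exists d => // a b ab; apply: (dE (a, b)).
  by rewrite /= -ball_normE.
have en_near : \forall n \near \oo, e n < d by apply: (cvgr_lt 0 e0).
apply: filterS en_near => n en.
by apply: EP => x Ax; apply: dE; exact: le_lt_trans (Fe n x Ax) en.
Qed.

(** * Even and odd parts of a double power series *)

Section PlaneSeries.
Variables (R : realType) (V : normedModType R).

(** The exponent pair (k - i, i): exponents of total degree k in two variables are enumerated by
    that of the second variable. *)
Definition plane_index k (i : 'I_k.+1) : {ffun 'I_2 -> 'I_k.+1} :=
  [ffun t => if t == ord0 then rev_ord i else i].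

Lemma sum_plane_index (U : nmodType) k (F : {ffun 'I_2 -> 'I_k.+1} -> U) :
  \sum_(s : {ffun 'I_2 -> 'I_k.+1} | mdeg s == k) F s = \sum_(i < k.+1) F (plane_index i).
Proof.
rewrite (reindex_onto (@plane_index k) (fun s => s ord_max)) /=; last first.
  move=> s; rewrite /mdeg big_ord_recl big_ord1 => /eqP sk; apply/ffunP => t.
  rewrite ffunE; have e1 : lift ord0 ord0 = ord_max :> 'I_2 by apply: val_inj.
  rewrite e1 in sk.
  case: eqP => [->|t0]; last first.
    by congr (s _); apply: val_inj; move: t t0 => [[|[|]]]//= p; case; apply: val_inj.
  by apply: val_inj => /=; rewrite subSS -[X in (X - _)%N]sk addnK.
apply: eq_bigl => i; rewrite ffunE eqxx andbT /mdeg big_ord_recl big_ord1 !ffunE /=.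
by rewrite subSS subnK ?eqxx// leq_ord.
Qed.

Definition plane_pt (u v : R) : 'rV[R]_2 := \row_i (if i == ord0 then u else v).

Lemma homog_plane (c : forall k, {ffun 'I_2 -> 'I_k.+1} -> V) u v k :
  homog c (plane_pt u v) k =
  \sum_(i < k.+1) (u ^+ (k - i) * v ^+ i) *: c k (plane_index (inord i)).
Proof.
rewrite /homog sum_plane_index; apply: eq_bigr => i _; rewrite inord_val.
congr (_ *: _); rewrite /monom big_ord_recl big_ord1 !mxE !ffunE /=.
by rewrite subSS.
Qed.

Lemma analytic_plane0 (g : R -> R -> V) :
  analytic_at (fun p : 'rV[R]_2 => g (p 0 0) (p 0 1)) 0 ->
  exists (A : nat -> nat -> V) (r0 : R), [/\ 0 < r0,
    forall r, 0 < r <= r0 ->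
      cvgn (series (fun k => \sum_(i < k.+1) `|A k i| * r ^+ k)) &
    forall u v, `|u| < r0 -> `|v| < r0 ->
      series (fun k => \sum_(i < k.+1) (u ^+ (k - i) * v ^+ i) *: A k i) @ \oo --> g u v].
Proof.
move=> [c [r0 [r00 cc cg]]].
exists (fun k i => c k (plane_index (inord i))), r0; split => // [r /andP[r1 r2]|u v ur vr].
  apply: series_le_cvg cc => k.
  - by apply: sumr_ge0 => i _; rewrite mulr_ge0 ?exprn_ge0 ?(ltW r1).
  - by apply: sumr_ge0 => i _; rewrite mulr_ge0 ?exprn_ge0 ?(ltW r00).
  - rewrite sum_plane_index; apply: ler_sum => i _; rewrite inord_val ler_wpM2l//.
    by rewrite lerXn2r// nnegrE ltW.
have h : `|plane_pt u v| < r0.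
  rewrite [ltLHS]/Num.Def.normr/= mx_normrE; apply/bigmax_ltP; split => // -[i j] _ /=.
  by rewrite mxE; case: ifP.
have := cg _ h; rewrite (funext (homog_plane c u v)).
by rewrite add0r !mxE.
Qed.

Definition axial_polyV (A : nat -> V) k (u w : R) : V :=
  \sum_(j < k./2.+1) (u ^+ (k - 2 * j) * w ^+ j) *: A j.

(** Averaging the series at v and -v deletes the odd powers of v, so their coefficients need not be
    shown to vanish. *)
Lemma even_part (A : nat -> nat -> V) (u v : R) (L : V) :
  series (fun k => \sum_(i < k.+1) (u ^+ (k - i) * v ^+ i) *: A k i) @ \oo --> L ->
  series (fun k => \sum_(i < k.+1) (u ^+ (k - i) * (- v) ^+ i) *: A k i) @ \oo --> L ->
  series (fun k => axial_polyV (fun j => A k (2 * j)%N) k u (v ^+ 2)) @ \oo --> L.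
Proof.
move=> h1 h2; have h := cvgD (FF := eventually_filter) h1 h2.
have := cvgZl_tmp (FF := eventually_filter) (k := 2^-1) h.
rewrite -mulr2n -[L *+ 2]scaler_nat scalerA mulVf ?pnatr_eq0// scale1r.
apply: cvg_trans; apply: near_eq_cvg; apply: nearW => n /=.
rewrite !fctE /series/= -big_split scaler_sumr; apply: eq_bigr => k _ /=.
rewrite -big_split /axial_polyV scaler_sumr.
rewrite -(sum_even (fun j => (u ^+ (k - 2 * j) * (v ^+ 2) ^+ j) *: A k (2 * j)%N)).
apply: eq_bigr => i _ /=; rewrite exprNn mulrCA -signr_odd; case: ifP => oi.
  by rewrite expr1 mulN1r scaleNr subrr scaler0.
rewrite expr0 mul1r -scalerDl scalerA -exprM mul2n halfK oi subn0.
by congr (_ *: _); field.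
Qed.

(** Half the difference of the series at v and -v keeps the odd powers. Pulling out one factor v
    lowers the degree by one, whence the coefficients of index k + 1. *)
Lemma odd_part (A : nat -> nat -> V) (u v : R) (L : V) :
  series (fun k => \sum_(i < k.+1) (u ^+ (k - i) * v ^+ i) *: A k i) @ \oo --> L ->
  series (fun k => \sum_(i < k.+1) (u ^+ (k - i) * (- v) ^+ i) *: A k i) @ \oo --> - L ->
  series (fun k => v *: axial_polyV (fun j => A k.+1 (2 * j).+1) k u (v ^+ 2)) @ \oo --> L.
Proof.
move=> h1 h2; have h := cvgB (FF := eventually_filter) h1 h2.
have := cvgZl_tmp (FF := eventually_filter) (k := 2^-1) h.
rewrite opprK -mulr2n -[L *+ 2]scaler_nat scalerA mulVf ?pnatr_eq0// scale1r.
rewrite -cvg_shiftS; apply: cvg_trans; apply: near_eq_cvg; apply: nearW => n /=.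
rewrite !fctE /series/= -sumrB scaler_sumr big_nat_recl//= !big_ord1 !expr0 subrr.
rewrite scaler0 add0r; apply: eq_bigr => k _ /=.
rewrite -sumrB /axial_polyV !scaler_sumr.
rewrite -(sum_odd (fun j => v *: ((u ^+ (k - 2 * j) * (v ^+ 2) ^+ j) *: A k.+1 (2 * j).+1))).
apply: eq_bigr => i _ /=; rewrite exprNn mulrCA -signr_odd; case: ifP => oi; last first.
  by rewrite expr0 mul1r subrr scaler0.
have i1 : (2 * i./2).+1 = i by rewrite mul2n -[RHS]odd_double_half oi.
rewrite expr1 mulN1r scaleNr opprK -scalerDl !scalerA -exprM i1.
have -> : (k - 2 * i./2 = k.+1 - i)%N by rewrite -{2}i1 subSS.
have vi : v ^+ i = v * v ^+ (2 * i./2) by rewrite -exprS i1.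
by rewrite vi; congr (_ *: _); field.
Qed.

Lemma even_majorant (A : nat -> nat -> V) r : 0 < r ->
  cvgn (series (fun k => \sum_(i < k.+1) `|A k i| * r ^+ k)) ->
  cvgn (series (fun k => \sum_(j < k./2.+1) `|A k (2 * j)%N| * r ^+ k)).
Proof.
move=> r0; have nneg k i : 0 <= `|A k i| * r ^+ k by rewrite mulr_ge0 ?exprn_ge0 ?(ltW r0).
apply: series_le_cvg => k; try by apply: sumr_ge0.
rewrite -(sum_even (fun j => `|A k (2 * j)%N| * r ^+ k)); apply: ler_sum => i _.
by case: ifP => oi //; rewrite mul2n halfK oi subn0.
Qed.

(** The degree shift is paid for by a factor 1/r on the shifted series. *)
Lemma odd_majorant (A : nat -> nat -> V) r : 0 < r ->
  cvgn (series (fun k => \sum_(i < k.+1) `|A k i| * r ^+ k)) ->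
  cvgn (series (fun k => \sum_(j < k./2.+1) `|A k.+1 (2 * j).+1| * r ^+ k)).
Proof.
move=> r0; have nneg k i : 0 <= `|A k i| * r ^+ k by rewrite mulr_ge0 ?exprn_ge0 ?(ltW r0).
move=> cA; pose S k := \sum_(i < k.+1) `|A k i| * r ^+ k.
have cS : cvgn (series (fun k => S k.+1)).
  rewrite (_ : series _ = [sequence series S n.+1]_n - cst (S 0%N)).
    apply: is_cvgB; last exact: is_cvg_cst.
    by apply: cvgP; rewrite cvg_shiftS; exact: cA.
  by apply/funext => n; rewrite /series/= !fctE big_nat_recl// addrC addKr.
have := is_cvg_seriesZ (k := r^-1) cS.
apply: series_le_cvg => k.
- by apply: sumr_ge0 => i _; rewrite mulr_ge0 ?exprn_ge0 ?(ltW r0).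
- by apply: mulr_ge0; [rewrite invr_ge0 ltW|apply: sumr_ge0].
rewrite -[leRHS]/(r^-1 * S k.+1) ler_pdivlMl// mulr_sumr.
under eq_bigr do rewrite mulrCA -exprS.
rewrite -(sum_odd (fun j => `|A k.+1 (2 * j).+1| * r ^+ k.+1)); apply: ler_sum => i _.
case: ifP => oi //; have i1 : (2 * i./2).+1 = i; last by rewrite i1.
by rewrite mul2n -[RHS]odd_double_half oi.
Qed.

End PlaneSeries.

Section CliffordSeries.
Variables (R : realType) (m : nat).
Local Notation C := (clifford R m).
Local Notation pt := 'rV[R]_m.+1.
Implicit Types (D : {set 'I_m}) (A B : nat -> nat -> C) (y : pt) (u w r : R).

Lemma coef_sum (I : Type) (s : seq I) (F : I -> C) D :
  coef (\sum_(i <- s) F i) D = \sum_(i <- s) coef (F i) D.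
Proof.
apply: (big_morph (fun c : C => coef c D)); last by rewrite /coef mxE.
by move=> c d; rewrite Defs.coefD.
Qed.

Lemma cvg_coef (F : nat -> C) (L : C) D : series F @ \oo --> L ->
  series (fun k => coef (F k) D) @ \oo --> coef L D.
Proof.
move=> FL; have -> : series (fun k => coef (F k) D) = (fun c => coef c D) \o series F.
  by apply/funext => n; rewrite /series/= coef_sum.
apply: continuous_cvg FL.
exact: (@coord_continuous R 1 #|{set 'I_m}| 0 (enum_rank D) L).
Qed.

Lemma coef_axial_polyV (a : nat -> C) k u w D :
  coef (axial_polyV a k u w) D = axial_poly (fun j => coef (a j) D) k u w.
Proof. by rewrite coef_sum; apply: eq_bigr => j _; rewrite Defs.coefZ; ring. Qed.

Lemma norm_axial_polyV_le (a : nat -> C) k u w r : 0 < r -> `|u| <= r -> `|w| <= r ^+ 2 ->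
  `|axial_polyV a k u w| <= \sum_(j < k./2.+1) `|a j| * r ^+ k.
Proof.
move=> r0 ur wr; apply: le_trans (ler_norm_sum _ _ _) _; apply: ler_sum => j _.
by rewrite normrZ mulrC ler_wpM2l// normrM !normrX mulrC monomial_le.
Qed.

Lemma axial_majorant_coef_cvg A r (phi : C -> R) : 0 < r -> (forall c, `|phi c| <= `|c|) ->
  cvgn (series (fun k => \sum_(j < k./2.+1) `|A k j| * r ^+ k)) ->
  cvgn (series (axial_majorant (fun k j => phi (A k j)) r)).
Proof.
move=> r0 phi_le; apply: series_le_cvg => k.
- by apply: sumr_ge0 => j _; rewrite mulr_ge0 ?exprn_ge0 ?(ltW r0).
- by apply: sumr_ge0 => j _; rewrite mulr_ge0 ?exprn_ge0 ?(ltW r0).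
- by apply: ler_sum => j _; rewrite ler_wpM2r ?exprn_ge0 ?(ltW r0).
Qed.

Lemma norm_coord_le y l : `|y 0 (lift ord0 l)| <= vnorm y.
Proof.
rewrite -sqrtr_sqr /vnorm ler_wsqrtr// (bigD1 l)//= lerDl.
by apply: sumr_ge0 => j _; exact: sqr_ge0.
Qed.

(** Each of the m generators contributes at most the norm of [c], since |y_l| is at most
    [vnorm y]. *)
Lemma norm_unit_vpartM_le y (c : C) :
  `|(vnorm y)^-1 *: vpart y * c| <= m%:R * `|c|.
Proof.
apply: norm_le_coef => [|D]; first by rewrite mulr_ge0.
rewrite -scalerAl Defs.coefZ coef_vpartM mulr_sumr.
apply: le_trans (ler_norm_sum _ _ _) _.
apply: (@le_trans _ _ (\sum_(l < m) `|c|)); last first.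
  by rewrite sumr_const card_ord mulr_natl.
apply: ler_sum => l _; rewrite mulrA normrM -[leRHS]mul1r ler_pM//; last exact: coef_egenM_le.
have v0 : 0 <= vnorm y by exact: sqrtr_ge0.
have [->|vn0] := eqVneq (vnorm y) 0; first by rewrite invr0 mul0r normr0.
rewrite normrM normfV (ger0_norm v0) mulrC ler_pdivrMr ?mul1r ?norm_coord_le//.
by rewrite lt_neqAle eq_sym vn0.
Qed.

(* [a] and [b] are the values of alpha and beta in the definition of an axially
   symmetric function; only even powers of the second variable survive in alpha
   and only odd ones in beta. *)
Definition axial_expansion (f : pt -> C) A B r :=
  forall y, in_region r y -> exists a b : C,
    [/\ series (fun k => axial_polyV (A k) k (x0of y) (rho y)) @ \oo --> a,
        series (fun k => vnorm y *: axial_polyV (B k) k (x0of y) (rho y)) @ \oo --> b &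
        f y = a + (vnorm y)^-1 *: vpart y * b].

Definition jetE A D := series_jet (fun k j => coef (A k j) D).

Definition jetO B D l := series_jet (fun k j => coef (egen R l * B k j) D).

Lemma axial_expansion_coef f A B r : axial_expansion f A B r ->
  forall D y, in_region r y -> coef (f y) D = axial (jetE A D) (jetO B D) y.
Proof.
move=> fAB D y /fAB [a [b [ca cb ->]]]; rewrite Defs.coefD /axial; congr (_ + _).
  apply/esym/cvg_lim => //; have := cvg_coef (D := D) ca.
  by under [X in series X]eq_fun do rewrite coef_axial_polyV.
have [v0|v0] := eqVneq (vnorm y) 0.
  rewrite (vpart_vnorm0 v0) scaler0 mul0r big1; first by rewrite /coef mxE.
  by move=> l _; rewrite vnorm_eq0// mul0r.
rewrite -scalerAl scalerAr coef_vpartM; apply: eq_bigr => l _; congr (_ * _).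
apply/esym/cvg_lim => //; rewrite coef_egenM.
have cb' : series (fun k => axial_polyV (B k) k (x0of y) (rho y)) @ \oo --> (vnorm y)^-1 *: b.
  have := cvgZl_tmp (FF := eventually_filter) (k := (vnorm y)^-1) cb.
  apply: cvg_trans; apply: near_eq_cvg; apply: nearW => n.
  rewrite /series/= scaler_sumr; apply: eq_bigr => k _.
  by rewrite scalerA mulVf// scale1r.
have := cvgZl_tmp (FF := eventually_filter) (k := csign R [set l]%SET (symdiff [set l]%SET D))
  (cvg_coef (D := symdiff [set l]%SET D) cb').
apply: cvg_trans; apply: near_eq_cvg; apply: nearW => n.
rewrite /series/= scaler_sumr; apply: eq_bigr => k _.
rewrite coef_axial_polyV -[_ *: _]/(_ * _) mulrC axial_poly_scale.
by apply: eq_bigr => j _; rewrite coef_egenM; ring.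
Qed.

End CliffordSeries.

(** * Identification of the components and uniform convergence *)

Section AxialExpansion.
Variables (R : realType) (m : nat).
Hypothesis m_gt0 : (0 < m)%N.
Local Notation C := (clifford R m).
Local Notation pt := 'rV[R]_m.+1.
Implicit Types (D : {set 'I_m}) (A B : nat -> nat -> C) (x y : pt) (u v w r : R).

Definition coef_summable A r :=
  cvgn (series (fun k => \sum_(j < k./2.+1) `|A k j| * r ^+ k)).

Lemma vnorm_ge0 y : 0 <= vnorm y. Proof. exact: sqrtr_ge0. Qed.

Lemma in_region_vnorm r y : 0 < r -> in_region r y -> vnorm y < r.
Proof.
move=> r0 [_ yr]; rewrite -(@ltr_pXn2r _ 2)// ?nnegrE ?vnorm_ge0 ?(ltW r0)//.
by rewrite vnorm_sqr.
Qed.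

Lemma in_region_norm r y : 0 < r -> in_region r y -> `|y| < r.
Proof.
move=> r0 yr; rewrite [ltLHS]/Num.Def.normr/= mx_normrE.
apply/bigmax_ltP; split => // -[i j] _ /=; rewrite ord1.
case: (unliftP ord0 j) => [l|] ->; last by case: yr.
exact: le_lt_trans (norm_coord_le _ _) (in_region_vnorm r0 yr).
Qed.

(** The origin of the plane lies in the profile, so alpha and beta have power series there. Their
    parity at (x0, |x_|) identifies the sums at v and -v, as the extraction of even and odd parts
    requires. *)
Lemma axial_expansion_exists (W : set pt) (f : pt -> C) :
  open W -> W 0 -> axially_harmonic W f ->
  exists A B r, [/\ 0 < r, coef_summable A r, coef_summable B r,
    forall y, in_region r y -> W y & axial_expansion f A B r].
Proof.
move=> oW W0 [_ [alpha [beta [ana anb eva odb fW]]] _].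
have [e /= e0 eW] : exists2 e : R, 0 < e & forall y : pt, `|y| < e -> W y.
  have /nbhs_ballP[e /= e0 eW] := open_nbhs_nbhs (conj oW W0).
  by exists e => // y ye; apply: eW; rewrite -ball_normE /= sub0r normrN.
have p0 : profile W 0.
  exists 0; split => //; first by rewrite /x0of !mxE.
  rewrite mxE normr0 /vnorm big1 ?sqrtr0// => j _.
  by rewrite mxE expr0n.
have [A [rA [rA0 cA sA]]] := analytic_plane0 (ana 0 p0).
have [B [rB [rB0 cB sB]]] := analytic_plane0 (anb 0 p0).
pose r := Num.min e (Num.min rA rB).
have r0 : 0 < r by rewrite !lt_min e0 rA0 rB0.
have [re rrA rrB] : [/\ r <= e, r <= rA & r <= rB].
  by rewrite /r !ge_min !lexx !orbT.
exists (fun k j => A k (2 * j)%N), (fun k j => B k.+1 (2 * j).+1), r; split => //.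
- by apply: even_majorant => //; apply: cA; rewrite r0.
- by apply: odd_majorant => //; apply: cB; rewrite r0.
- by move=> y yr; apply: eW; apply: lt_le_trans (in_region_norm r0 yr) re.
move=> y yr; have Wy : W y by apply: eW; apply: lt_le_trans (in_region_norm r0 yr) re.
exists (alpha (x0of y) (vnorm y)), (beta (x0of y) (vnorm y)).
have py v : `|v| = vnorm y -> profile W (plane_pt (x0of y) v).
  by move=> vy; exists y; rewrite !mxE.
have nv : `|vnorm y| = vnorm y by rewrite ger0_norm// vnorm_ge0.
have nNv : `|- vnorm y| = vnorm y by rewrite normrN.
have vr := in_region_vnorm r0 yr; have [ur _] := yr.
have := eva _ (py _ nv); rewrite !mxE/= => av.
have := odb _ (py _ nv); rewrite !mxE/= => bv.
rewrite -vnorm_sqr; split; last exact: fW.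
  apply: even_part; first by apply: sA; rewrite ?nv (lt_le_trans _ rrA).
  by rewrite -av; apply: sA; rewrite ?nNv (lt_le_trans _ rrA).
apply: (@odd_part _ _ B); first by apply: sB; rewrite ?nv (lt_le_trans _ rrB).
by rewrite -bv; apply: sB; rewrite ?nNv (lt_le_trans _ rrB).
Qed.

Section Harmonic.
Variables (f : pt -> C) (A B : nat -> nat -> C) (r : R).
Hypotheses (r0 : 0 < r) (cA : coef_summable A r) (cB : coef_summable B r).
Hypothesis fAB : axial_expansion f A B r.
Hypothesis f_harm : forall y, in_region r y -> laplacian f y = 0.

Let jE D : is_jet r (jetE A D).
Proof.
apply: is_jet_series_jet => //; apply: (axial_majorant_coef_cvg (phi := fun c => coef c D)) => // c.
exact: coef_norm_le.
Qed.

Let jO D l : is_jet r (jetO B D l).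
Proof.
apply: is_jet_series_jet => //.
apply: (axial_majorant_coef_cvg (phi := fun c => coef (egen R l * c) D)) => // c.
exact: coef_egenM_le.
Qed.

Let l0 : 'I_m := Ordinal m_gt0.

(** The point u + v e_1: [rho] is v^2 while [v] may have either sign, and a single summand of x_ O
    survives. *)
Definition axis_pt u v : pt :=
  \row_i (if i == ord0 then u else if i == lift ord0 l0 then v else 0).

Lemma axis_pt_coord u v l : (axis_pt u v) 0 (lift ord0 l) = if l == l0 then v else 0.
Proof. by rewrite mxE eq_sym (negbTE (neq_lift _ _)) (inj_eq lift_inj). Qed.

Lemma x0of_axis u v : x0of (axis_pt u v) = u.
Proof. by rewrite /x0of mxE. Qed.

Lemma rho_axis u v : rho (axis_pt u v) = v ^+ 2.
Proof.
rewrite /rho (bigD1 l0)//= axis_pt_coord eqxx big1 ?addr0// => l ll0.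
by rewrite axis_pt_coord (negbTE ll0) expr0n.
Qed.

Lemma jet_lap_axis u v D : `|u| < r -> v ^+ 2 < r ^+ 2 ->
  jet_lap m%:R (jetE A D) u (v ^+ 2) + v * jet_lap (m%:R + 2) (jetO B D l0) u (v ^+ 2) = 0.
Proof.
move=> ur vr; have xr : in_region r (axis_pt u v).
  by split; rewrite ?x0of_axis ?rho_axis.
have := coef_axial_laplacian jE jO xr (axial_expansion_coef fAB) D.
rewrite f_harm// x0of_axis rho_axis (bigD1 l0)//= axis_pt_coord eqxx big1 ?addr0.
  by rewrite {1}/coef mxE => <-.
by move=> l ll0; rewrite axis_pt_coord (negbTE ll0) mul0r.
Qed.

(** Harmonicity at v and -v, with v^2 = w, gives p + v q = 0 and p - v q = 0. *)
Lemma jet_lap_separate u w D : 0 < u < r -> 0 < w < r ^+ 2 ->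
  jet_lap m%:R (jetE A D) u w = 0 /\ jet_lap (m%:R + 2) (jetO B D l0) u w = 0.
Proof.
move=> /andP[u0 ur] /andP[w0 wr]; pose v := Num.sqrt w.
have v0 : 0 < v by rewrite sqrtr_gt0.
have v2 : v ^+ 2 = w by rewrite sqr_sqrtr// ltW.
have u1 : `|u| < r by rewrite gtr0_norm.
have h1 := @jet_lap_axis u v D u1; have h2 := @jet_lap_axis u (- v) D u1.
rewrite sqrrN v2 in h2; rewrite v2 in h1; have {}h1 := h1 wr; have {}h2 := h2 wr.
move: h1 h2; move: (jet_lap _ _ _ _) (jet_lap _ _ _ _) => q p h1 h2.
have p0 : p = 0 by lra.
by split => //; move/eqP: h1; rewrite p0 add0r mulf_eq0 gt_eqF// => /eqP.
Qed.

Let m0 : 0 < m%:R :> R. Proof. by rewrite ltr0n. Qed.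

Lemma even_coef k j : (j <= k./2)%N -> A k j = hgck_coef (m%:R / 2) k j *: A k 0%N.
Proof.
move=> jk; apply: clifford_eqP => D; rewrite Defs.coefZ.
apply: (lap_coef_unique (a := fun j => coef (A k j) D) m0) => // i ik.
apply: (@jet_lap_series_jet_unique R (fun k j => coef (A k j) D) r) => // [|u w ur wr].
  by apply: (axial_majorant_coef_cvg (phi := fun c => coef c D)) => // c; exact: coef_norm_le.
by case: (@jet_lap_separate u w D ur wr).
Qed.

Lemma egen_sqr l (c : C) : egen R l * (egen R l * c) = - c.
Proof.
have := egen_anticomm R l l; rewrite eqxx mulr1 -mulr2n -scaler_nat => h.
have {}h : egen R l * egen R l = - 1.
  apply: (@scalerI _ _ (2 : R)); first by rewrite pnatr_eq0.
  by rewrite h scaleNr scalerN.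
by rewrite mulrA h mulN1r.
Qed.

(** The recursion is available for the coordinates of e_1 B only; a second multiplication by e_1
    recovers B up to sign. *)
Lemma odd_coef k j : (j <= k./2)%N -> B k j = hgck_coef (m%:R / 2 + 1) k j *: B k 0%N.
Proof.
have e2 : (m%:R / 2 + 1 : R) = (m%:R + 2) / 2 by field.
have m2 : 0 < m%:R + 2 :> R by rewrite addr_gt0.
move=> jk; suff : egen R l0 * B k j = hgck_coef (m%:R / 2 + 1) k j *: (egen R l0 * B k 0%N).
  move=> /(congr1 (fun c => egen R l0 * c)); rewrite -scalerAr !egen_sqr scalerN.
  exact: oppr_inj.
rewrite e2; apply: clifford_eqP => D; rewrite Defs.coefZ.
apply: (lap_coef_unique (a := fun j => coef (egen R l0 * B k j) D) m2) => // i ik.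
apply: (@jet_lap_series_jet_unique R (fun k j => coef (egen R l0 * B k j) D) r) => // [|u w ur wr].
  apply: (axial_majorant_coef_cvg (phi := fun c => coef (egen R l0 * c) D)) => // c.
  exact: coef_egenM_le.
by case: (@jet_lap_separate u w D ur wr).
Qed.

Lemma axial_polyV_scale (c : nat -> R) (a : nat -> C) k u w :
  (forall j, (j <= k./2)%N -> a j = c j *: a 0%N) ->
  axial_polyV a k u w = axial_poly c k u w *: a 0%N.
Proof.
move=> ac; rewrite scaler_suml; apply: eq_bigr => j _.
by rewrite ac ?leq_ord// scalerA; congr (_ *: _); ring.
Qed.

Lemma H0_component k x : H0 k x * A k 0%N = axial_polyV (A k) k (x0of x) (rho x).
Proof.
by rewrite H0E// mulr_algl (axial_polyV_scale _ _ (@even_coef k)).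
Qed.

Lemma H1_component k x : H1 k x * B k 0%N = vpart x * axial_polyV (B k) k (x0of x) (rho x).
Proof.
by rewrite H1E// (axial_polyV_scale _ _ (@odd_coef k)) -scalerAl -scalerAr.
Qed.

(** The bound does not depend on [x], which yields uniform convergence. The factor r bounds |x_| in
    the odd part, and m bounds multiplication by the unit vector. *)
Lemma expansion_error n x : in_region r x ->
  `|f x - \sum_(k < n) (H0 k x * A k 0%N + H1 k x * B k 0%N)| <=
  (limn (series (fun k => \sum_(j < k./2.+1) `|A k j| * r ^+ k)) -
     series (fun k => \sum_(j < k./2.+1) `|A k j| * r ^+ k) n) +
  m%:R * (limn (series (r *: (fun k => \sum_(j < k./2.+1) `|B k j| * r ^+ k))) -
     series (r *: (fun k => \sum_(j < k./2.+1) `|B k j| * r ^+ k)) n).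
Proof.
move=> xr; have [a [b [ca cb ->]]] := fAB xr; have [ur rr] := xr.
have vr := in_region_vnorm r0 xr.
have rr' : `|rho x| <= r ^+ 2 by rewrite ger0_norm ?rho_ge0// ltW.
pose FA k := axial_polyV (A k) k (x0of x) (rho x).
pose FB k := vnorm x *: axial_polyV (B k) k (x0of x) (rho x).
have -> : \sum_(k < n) (H0 k x * A k 0%N + H1 k x * B k 0%N) =
    series FA n + (vnorm x)^-1 *: vpart x * series FB n.
  rewrite /series/= !big_mkord mulr_sumr -big_split; apply: eq_bigr => k _ /=.
  by rewrite /FA /FB vnorm_cancel -(H0_component k x) -(H1_component k x).
rewrite opprD addrACA -mulrBr; apply: le_trans (ler_normD _ _) _; apply: lerD.
  apply: series_tail_le => // k; apply: norm_axial_polyV_le => //; exact: ltW.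
apply: le_trans (norm_unit_vpartM_le _ _) _; rewrite ler_wpM2l//.
apply: series_tail_le => // [k|]; last exact: is_cvg_seriesZ.
rewrite normrZ; apply: ler_pM => //; first by rewrite ger0_norm ?vnorm_ge0// ltW.
apply: norm_axial_polyV_le => //; exact: ltW.
Qed.

(** The ball is for the supremum norm: m squares below (r/(m+1))^2 sum to less than r^2. *)
Lemma ball_in_region x : ball (0 : pt) (r / m.+1%:R) x -> in_region r x.
Proof.
have m1 : 0 < m.+1%:R :> R by rewrite ltr0n.
rewrite -ball_normE /= sub0r normrN => xr.
have coord_lt i : `|x 0 i| < r / m.+1%:R.
  apply: le_lt_trans xr; rewrite [leRHS]/Num.Def.normr/= mx_normrE.
  exact: (le_bigmax _ (fun i => `|x i.1 i.2|) (0, i)).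
have rm : r / m.+1%:R <= r by rewrite ler_pdivrMr// ler_peMr ?ler1n// ltW.
split; first exact: lt_le_trans (coord_lt _) rm.
apply: (@le_lt_trans _ _ (\sum_(l < m) (r / m.+1%:R) ^+ 2)).
  apply: ler_sum => l _; rewrite -[leLHS]real_normK ?num_real//.
  by rewrite lerXn2r ?nnegrE ?divr_ge0 ?(ltW r0)// ltW.
rewrite sumr_const card_ord -(mulr_natl (_ ^+ _)) expr_div_n mulrA ltr_pdivrMr ?exprn_gt0//.
rewrite mulrC ltr_pM2l ?exprn_gt0// -natrX ltr_nat.
by rewrite expnS expn1 (leq_trans (ltnSn m))// leq_pmulr.
Qed.

Lemma axial_expansion_uniform :
  {uniform ball (0 : pt) (r / m.+1%:R),
    (fun (n : nat) x => \sum_(k < n) (H0 k x * A k 0%N + H1 k x * B k 0%N)) @ \oo --> f}.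
Proof.
apply: uniform_cvgP => [n x /ball_in_region xr|]; first exact: expansion_error xr.
rewrite -[X in _ --> X]addr0; apply: cvgD; first exact: cvg_series_tail.
rewrite -[X in _ --> X](mulr0 m%:R); apply: cvgMl_tmp.
by apply: cvg_series_tail; exact: is_cvg_seriesZ.
Qed.

End Harmonic.

End AxialExpansion.

Theorem theorem6p12 (R : realType) (m : nat) (m_gt0 : (0 < m)%N) :
  [/\ (forall k : nat,
         [/\ polynomial_fun (@H0 R m k), axially_harmonic setT (@H0 R m k),
             polynomial_fun (@H1 R m k) & axially_harmonic setT (@H1 R m k)]),
      (forall (W : set 'rV[R]_m.+1) (f : 'rV[R]_m.+1 -> clifford R m),
         open W -> axially_symmetric W -> W 0 -> axially_harmonic W f ->
         exists (a b : nat -> clifford R m) (r : R),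
           [/\ 0 < r, ball (0 : 'rV[R]_m.+1) r `<=` W
             & {uniform ball (0 : 'rV[R]_m.+1) r,
                 (fun (n : nat) x =>
                    \sum_(k < n) (H0 k x * a k + H1 k x * b k)) @ \oo --> f}])
    & (forall (k : nat) (x : 'rV[R]_m.+1),
         H0 k x = grade 0 (clifford_appell k x) /\
         H1 k x = (m%:R / k.+1%:R) *: grade 1 (clifford_appell k.+1 x))].
Proof.
split => [k|W f oW _ W0 fW|k x].
- split; [exact: H0_polynomial|exact: H0_axially_harmonic
         |exact: H1_polynomial|exact: H1_axially_harmonic].
- have [A [B [r [r0 cA cB rW fAB]]]] := axial_expansion_exists oW W0 fW.
  have f_harm y : in_region r y -> laplacian f y = 0.
    by move=> /rW; case: fW => _ _; exact.
  exists (fun k => A k 0%N), (fun k => B k 0%N), (r / m.+1%:R); split.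
  + by rewrite divr_gt0// ltr0n.
  + by move=> x /(ball_in_region r0) /rW.
  + by refine (axial_expansion_uniform m_gt0 r0 cA cB fAB f_harm).
- by rewrite grade0_clifford_appell// grade1_clifford_appell// H0E// H1E.
Qed.
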